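(* In the setting described in the context, suppose that $\eta<\vartheta$, that $\mathbf c=\langle C^i_n:n<\omega,i<2\rangle\in\mathfrak M$ is an $\mathbf{MT}(\vec P)$-real name, and that for every $k<\omega$ the set $D(k)=\{\tau\in\mathbf{MT}(\vec P):\tau\text{ directly forces }\mathbf c\neq\boldsymbol\pi_{\eta k}\}$ is dense in $\mathbf{MT}(\vec P)$. Let $\nu\in\mathbf{MT}(\vec P\vee\vec U)$ and $U\in U_\eta$. Then there is a multitree $\nu'\in\mathbf{MT}(\vec U)$ with $\nu'\le\nu$ which directly forces $\mathbf c\notin[U]$.
   Context: $2^{<\omega}$ finite binary strings; a tree is a subset of $2^{<\omega}$ closed under initial segments; $\mathbf{PT}$ the nonempty perfect trees; $\mathrm{stem}(T)$ the largest string comparable with all elements of $T$; $T\upharpoonright s=\{t\in T:s\subseteq t\lor t\subseteq s\}$; $[T]=\{a\in2^\omega:\forall n\,a\upharpoonright n\in T\}$. A perfect-tree forcing notion is $P\subseteq\mathbf{PT}$ with $T\upharpoonright u\in P$ whenever $u\in T\in P$. A finite splitting system over $P$ is $\varphi=\langle T_s:s\in 2^{<n}\rangle$ with $T_s\in P$ and, for $s^\frown i\in 2^{<n}$, $T_{s^\frown i}\subseteq T_s$ and $\mathrm{stem}(T_s)^\frown i\subseteq\mathrm{stem}(T_{s^\frown i})$; $\psi\preceq\varphi$ means $\varphi$ extends $\psi$. Multitrees: for $\vec Q=\langle Q_\xi:\xi<\vartheta\rangle$ perfect-tree forcing notions, a $\vec Q$-multitree is $\tau=\langle T_{\xi k}:\xi<\vartheta,k<\omega\rangle$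 with each $T_{\xi k}\in Q_\xi$ or $=2^{<\omega}$, finite support $|\tau|=\{\langle\xi,k\rangle:T_{\xi k}\neq2^{<\omega}\}$; $\mathbf{MT}(\vec Q)$ is the set of them ordered componentwise by $\subseteq$; $[\tau]=\{x\in(2^\omega)^{\vartheta\times\omega}:\forall\langle\xi,k\rangle\in|\tau|\ x(\xi,k)\in[\tau(\xi,k)]\}$. $\vec P\vee\vec Q=\langle P_\xi\cup Q_\xi\rangle_\xi$. Real names: an $\mathbf{MT}(\vec P)$-real name is $\mathbf c=\langle C^i_n:n<\omega,i<2\rangle$ with $C^i_n\subseteq\mathbf{MT}(\vec P)$, each $C^0_n\cup C^1_n$ pre-dense in $\mathbf{MT}(\vec P)$, and every element of $C^0_n$ incompatible with every element of $C^1_n$. For $\xi<\vartheta,k<\omega$, $\boldsymbol\pi_{\xi k}$ is the name with $C^i_n=\{\rho^{\xi k}_{ni}\}$, where $\rho^{\xi k}_{ni}$ has support $\{\langle\xi,k\rangle\}$ and $\rho^{\xi k}_{ni}(\xi,k)=\{s\in2^{<\omega}:|s|>n\Rightarrow s(n)=i\}$. A multitree $\tau$ directly forces $\mathbf c(n)=i$ iff there is a finite $\Sigma\subseteq C^i_n$ with $[\tau]\subseteq\bigcup_{\sigma\in\Sigma}[\sigma]$; directly forces $s\subset\mathbf c$ ($s\in2^{<\omega}$) iff it directly forces $\mathbf c(n)=s(n)$ for all $n<|s|$; directly forces $\mathbf d\neq\mathbf c$ iff there are $\subseteq$-incomparable $s,t$ such that it directly forces $s\subset\mathbf c$ and $t\subset\mathbf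 d$; directly forces $\mathbf c\notin[T]$ iff for some $s\in2^{<\omega}\setminus T$ it directly forces $s\subset\mathbf c$. Setting: ZFC$'$ is ZFC minus Power Set plus ''$\mathcal P(\omega)$ exists''; $\mathfrak M$ a countable transitive model of ZFC$'$; $\vec P=\langle P_\xi:\xi<\vartheta\rangle\in\mathfrak M$, $\vartheta<\omega_1^{\mathfrak M}$, perfect-tree forcing notions countable in $\mathfrak M$. A $\vec P$-multisystem is $\Phi=\langle\varphi_{\xi m}:\xi<\vartheta,m<\omega\rangle$, each $\varphi_{\xi m}$ a finite splitting system over $P_\xi$, finitely many nonempty, ordered componentwise by $\preceq$. $\langle\Phi^j:j<\omega\rangle$ is a $\preceq$-increasing sequence of $\vec P$-multisystems meeting every dense set of $\vec P$-multisystems belonging to $\mathfrak M$. Then $\bigcup_j\Phi^j(\xi,m)=\langle T^{\xi m}_s:s\in 2^{<\omega}\rangle$ with $T^{\xi m}_s\in P_\xi$; $U^{\xi m}_s=\bigcap_{n\ge|s|}\bigcup_{t\in 2^n,\,s\subseteq t}T^{\xi m}_t$; $U_\xi=\{U^{\xi m}_s:m<\omega,\ s\in 2^{<\omega}\}$; $\vec U=\langle U_\xi:\xi<\vartheta\rangle$. *)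

(* Defs.v *)
From mathcomp Require Import all_boot.
From mathcomp Require Import boolp classical_sets functions cardinality.

Set Implicit Arguments.
Unset Strict Implicit.
Unset Printing Implicit Defensive.

Local Open Scope classical_set_scope.

(** [V] is Aczel's type of well-founded trees modulo extensional equality.
    It is a quotient, so Leibniz equality on [V] is extensional ([V_ext]). *)

Inductive preset : Type := Sup (A : Type) (f : A -> preset).

Fixpoint peq (x y : preset) : Prop :=
  match x, y with
  | Sup A f, Sup B g =>
      (forall a, exists b, peq (f a) (g b)) /\
      (forall b, exists a, peq (f a) (g b))
  end.

Definition V : Type := {C : set preset | exists x, C = peq x}.

Definition vmem (x y : V) : Prop :=
  exists (B : Type) (g : B -> preset) (b : B),
    proj1_sig y (Sup g) /\ proj1_sig x (g b).

Definition elts (y : V) : set V := [set x | vmem x y].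

Definition vclass (p : preset) : V := exist _ (peq p) (ex_intro _ p erefl).

(** The set whose elements are exactly the members of [A].  If there is no
    such set (that is, [A] is a proper class) the value is irrelevant; every
    use below is at a class that is a set, see [setof_range]. *)
Definition setof (A : set V) : V :=
  if pselect (exists x, elts x = A) is left h then projT1 (cid h)
  else vclass (Sup (fun e : Empty_set => match e with end)).

Lemma peq_refl x : peq x x.
Proof. by elim: x => A f IH /=; split=> a; exists a. Qed.

Lemma peq_sym x y : peq x y -> peq y x.
Proof.
elim: x y => A f IH [B g] /= [h1 h2]; split.
- by move=> b; have [a /IH ?] := h2 b; exists a.
- by move=> a; have [b /IH ?] := h1 a; exists b.
Qed.

Lemma peq_trans x y z : peq x y -> peq y z -> peq x z.
Proof.
elim: x y z => A f IH [B g] [C h] /= [h1 h2] [k1 k2]; split.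
- move=> a; have [b hb] := h1 a; have [c hc] := k1 b.
  by exists c; exact: IH hb hc.
- move=> c; have [b hb] := k2 c; have [a ha] := h2 b.
  by exists a; exact: IH ha hb.
Qed.

Lemma vclassP (x : V) : exists p, x = vclass p.
Proof. by case: x => C [p Cp]; exists p; apply: eq_exist. Qed.

Lemma vclass_eq p q : peq p q -> vclass p = vclass q.
Proof.
move=> pq; apply: eq_exist; apply/predeqP => r.
by split; [apply: peq_trans; exact: peq_sym | exact: peq_trans].
Qed.

Lemma vmem_vclass (x : V) A (f : A -> preset) :
  vmem x (vclass (Sup f)) <-> exists a, x = vclass (f a).
Proof.
split=> [[B [g [b [/= [_ h]]]]]|[a ->]]; last first.
  by exists A, f, a; split; exact: peq_refl.
have [p ->] := vclassP x => /= pb; have [a ab] := h b.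
by exists a; apply: vclass_eq; exact: peq_trans pb (peq_sym ab).
Qed.

Lemma V_ext (x y : V) : elts x = elts y -> x = y.
Proof.
have [[A f] ->] := vclassP x; have [[B g] ->] := vclassP y => xy.
have e z : (exists a, z = vclass (f a)) <-> (exists b, z = vclass (g b)).
  by rewrite -!vmem_vclass; exact: (predeqP _ _).1 xy z.
have peqE p q : vclass p = vclass q -> peq p q.
  by move=> /(congr1 (fun z => proj1_sig z q)) /= ->; exact: peq_refl.
apply: vclass_eq; split=> [a|b].
- by have [|b /peqE] := (e (vclass (f a))).1; [exists a | exists b].
- by have [|a /peqE/peq_sym] := (e (vclass (g b))).2; [exists b | exists a].
Qed.

Lemma setofP (A : set V) : (exists x, elts x = A) -> elts (setof A) = A.
Proof. by rewrite /setof; case: pselect => // h _; case: cid. Qed.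

Lemma setof_range (I : Type) (f : I -> V) : elts (setof (range f)) = range f.
Proof.
apply: setofP; have [g gE] := choice (fun i => vclassP (f i)).
exists (vclass (Sup g)); apply/predeqP => x.
split=> [/vmem_vclass[i ->]|[i _ <-]]; first by exists i.
by apply/vmem_vclass; exists i.
Qed.

Definition opair (a b : V) : V :=
  setof [set setof [set a]; setof [set a; b]].

Fixpoint vnat (n : nat) : V :=
  if n is m.+1 then setof (elts (vnat m) `|` [set vnat m]) else setof set0.

Definition code_set {T : Type} (c : T -> V) (A : set T) : V := setof (c @` A).

Definition code_fun {A B : Type} (cA : A -> V) (cB : B -> V) (f : A -> B) : V :=
  setof (range (fun a => opair (cA a) (cB (f a)))).

Definition vtransitive (x : V) : Prop := forall y, vmem y x -> elts y `<=` elts x.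

(** Well-foundedness of membership is automatic in [V]. *)
Definition vordinal (x : V) : Prop :=
  vtransitive x /\ forall y, vmem y x -> vtransitive y.

(** Variables are de Bruijn indices. *)
Inductive formula : Type :=
  | FMem of nat & nat
  | FEq of nat & nat
  | FNot of formula
  | FImp of formula & formula
  | FAll of formula.

Section Theory.
Variables (D : Type) (E : D -> D -> Prop).

Definition scons (x : D) (e : nat -> D) : nat -> D :=
  fun n => if n is m.+1 then e m else x.

Fixpoint holds (e : nat -> D) (phi : formula) : Prop :=
  match phi with
  | FMem i j => E (e i) (e j)
  | FEq i j => e i = e j
  | FNot phi => ~ holds e phi
  | FImp phi psi => holds e phi -> holds e psi
  | FAll phi => forall x, holds (scons x e) phi
  end.

Definition ax_extensionality : Prop :=
  forall x y, (forall z, E z x <-> E z y) -> x = y.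

Definition ax_foundation : Prop :=
  forall x, (exists y, E y x) -> exists2 y, E y x & forall z, E z x -> ~ E z y.

Definition ax_pairing : Prop :=
  forall x y, exists z, forall w, E w z <-> w = x \/ w = y.

Definition ax_union : Prop :=
  forall x, exists u, forall w, E w u <-> exists2 y, E w y & E y x.

Definition inductive_set (w : D) : Prop :=
  (exists2 z, E z w & forall x, ~ E x z) /\
  (forall n, E n w -> exists2 m, E m w & forall x, E x m <-> E x n \/ x = n).

Definition ax_infinity : Prop := exists w, inductive_set w.

Definition is_omega (w : D) : Prop :=
  inductive_set w /\ forall v, inductive_set v -> forall n, E n w -> E n v.

Definition ax_separation : Prop :=
  forall (phi : formula) (e : nat -> D) (a : D),
  exists b, forall x, E x b <-> E x a /\ holds (scons x e) phi.

Definition ax_replacement : Prop :=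
  forall (phi : formula) (e : nat -> D) (a : D),
  (forall x y z, E x a -> holds (scons x (scons y e)) phi ->
     holds (scons x (scons z e)) phi -> y = z) ->
  exists b, forall y,
    E y b <-> exists2 x, E x a & holds (scons x (scons y e)) phi.

Definition ax_choice : Prop :=
  forall x,
  (forall y, E y x -> exists z, E z y) ->
  (forall y y' z, E y x -> E y' x -> E z y -> E z y' -> y = y') ->
  exists s, forall y, E y x -> exists! z, E z y /\ E z s.

Definition ax_power_omega : Prop :=
  exists2 w, is_omega w &
  exists p, forall x, E x p <-> forall n, E n x -> E n w.

(** ZFC minus Power Set plus the existence of P(omega).  Replacement is not
    strengthened to Collection, nor Choice to the well-ordering principle. *)
Definition ZFC' : Prop :=
  [/\ ax_extensionality, ax_foundation, ax_pairing & ax_union] /\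
  [/\ ax_infinity, ax_separation, ax_replacement, ax_choice & ax_power_omega].

End Theory.

Definition countable_transitive_model (M : set V) : Prop :=
  [/\ countable M,
      forall x y, M x -> vmem y x -> M y
    & ZFC' (fun x y : {x : V | M x} => vmem (proj1_sig x) (proj1_sig y))].

Definition countable_in (M : set V) (x : V) : Prop :=
  exists g : {a : V | vmem a x} -> nat,
    injective g /\ M (code_fun (@proj1_sig _ _) vnat g).

(** Membership in omega_1^M, the set of the ordinals countable in [M]. *)
Definition lt_omega1_in (M : set V) (theta : V) : Prop :=
  [/\ M theta, vordinal theta & countable_in M theta].

Definition tree : Type := set (seq bool).

Definition is_tree (T : tree) : Prop :=
  forall s t, prefix s t -> T t -> T s.

Definition perfect_tree (T : tree) : Prop :=
  [/\ is_tree T, T !=set0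
    & forall s, T s -> exists t,
        [/\ prefix s t, T (rcons t false) & T (rcons t true)]].

Definition comparable_str (s t : seq bool) : Prop := prefix s t \/ prefix t s.

Definition is_stem (T : tree) (s : seq bool) : Prop :=
  (forall t, T t -> comparable_str s t) /\
  (forall s', (forall t, T t -> comparable_str s' t) -> prefix s' s).

Definition stem (T : tree) : seq bool := xget [::] [set s | is_stem T s].

Definition restrict_tree (T : tree) (s : seq bool) : tree :=
  [set t | T t /\ comparable_str s t].

Definition body (T : tree) : set (nat -> bool) :=
  [set a | forall n, T (mkseq a n)].

Definition ptforcing (P : set tree) : Prop :=
  P `<=` perfect_tree /\ forall T u, P T -> T u -> P (restrict_tree T u).

(** A system is a partial function on strings, undefined meaning [None]. *)
Definition system : Type := seq bool -> option tree.

Definition splitting_system (P : set tree) (phi : system) : Prop :=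
  [/\ exists n, forall s, isSome (phi s) = (size s < n),
      forall s T, phi s = Some T -> P T
    & forall s i T T', phi s = Some T -> phi (rcons s i) = Some T' ->
        T' `<=` T /\ prefix (rcons (stem T) i) (stem T')].

Definition system_le (psi phi : system) : Prop :=
  forall s T, psi s = Some T -> phi s = Some T.

Definition below (theta : V) : Type := {xi : V | vmem xi theta}.

Definition index (theta : V) : Type := (below theta * nat)%type.

Definition multitree (theta : V) : Type := index theta -> tree.

Definition support theta (tau : multitree theta) : set (index theta) :=
  [set p | tau p <> setT].

Definition MT theta (Q : below theta -> set tree) : set (multitree theta) :=
  [set tau | (forall p, Q p.1 (tau p) \/ tau p = setT) /\
             finite_set (support tau)].

Definition mt_le theta (sigma tau : multitree theta) : Prop :=
  forall p, sigma p `<=` tau p.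

Definition mt_body theta (tau : multitree theta) :
    set (index theta -> nat -> bool) :=
  [set x | forall p, support tau p -> body (tau p) (x p)].

Definition family_join theta (P Q : below theta -> set tree) :
    below theta -> set tree := fun xi => P xi `|` Q xi.

Definition compatible theta (Q : below theta -> set tree)
    (sigma tau : multitree theta) : Prop :=
  exists rho, [/\ MT Q rho, mt_le rho sigma & mt_le rho tau].

Definition mt_predense theta (Q : below theta -> set tree)
    (A : set (multitree theta)) : Prop :=
  forall tau, MT Q tau -> exists2 sigma, A sigma & compatible Q sigma tau.

Definition mt_dense theta (Q : below theta -> set tree)
    (D : set (multitree theta)) : Prop :=
  D `<=` MT Q /\
  forall tau, MT Q tau -> exists2 sigma, D sigma & mt_le sigma tau.

Definition multisystem (theta : V) : Type := index theta -> system.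

Definition MS theta (P : below theta -> set tree) : set (multisystem theta) :=
  [set Phi | (forall p, splitting_system (P p.1) (Phi p)) /\
             finite_set [set p | exists s, isSome (Phi p s)]].

Definition ms_le theta (Psi Phi : multisystem theta) : Prop :=
  forall p, system_le (Psi p) (Phi p).

Definition ms_dense theta (P : below theta -> set tree)
    (D : set (multisystem theta)) : Prop :=
  D `<=` MS P /\
  forall Psi, MS P Psi -> exists2 Phi, D Phi & ms_le Psi Phi.

(** [c (n, i)] is the set C^i_n. *)
Definition rname (theta : V) : Type := nat * bool -> set (multitree theta).

Definition real_name theta (P : below theta -> set tree) (c : rname theta) :
    Prop :=
  [/\ forall n i, c (n, i) `<=` MT P,
      forall n, mt_predense P (c (n, false) `|` c (n, true))
    & forall n sigma tau, c (n, false) sigma -> c (n, true) tau ->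
        ~ compatible P sigma tau].

(** At an index [p <> q] the component is the full tree. *)
Definition rho theta (q : index theta) (n : nat) (i : bool) : multitree theta :=
  fun p => [set s | p = q -> n < size s -> nth false s n = i].

Definition pi_name theta (q : index theta) : rname theta :=
  fun ni => [set rho q ni.1 ni.2].

Definition forces_value theta (tau : multitree theta) (c : rname theta)
    (n : nat) (i : bool) : Prop :=
  exists Sigma : set (multitree theta),
    [/\ finite_set Sigma, Sigma `<=` c (n, i)
      & mt_body tau `<=` \bigcup_(sigma in Sigma) mt_body sigma].

Definition forces_initial theta (tau : multitree theta) (c : rname theta)
    (s : seq bool) : Prop :=
  forall n, n < size s -> forces_value tau c n (nth false s n).

Definition forces_neq theta (tau : multitree theta) (d c : rname theta) :
    Prop :=
  exists s t, [/\ ~ comparable_str s t, forces_initial tau c s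
                & forces_initial tau d t].

Definition forces_notin theta (tau : multitree theta) (c : rname theta)
    (T : tree) : Prop :=
  exists2 s, ~ T s & forces_initial tau c s.

(** The set-theoretic objects that the types above stand for: an object
    belongs to a model [M] when its code does. *)

Definition code_string (s : seq bool) : V :=
  setof [set opair (vnat n) (vnat (nth false s n)) | n in [set n | n < size s]].

Definition code_tree : tree -> V := code_set code_string.

Definition code_index theta (p : index theta) : V :=
  opair (proj1_sig p.1) (vnat p.2).

Definition code_family theta (P : below theta -> set tree) : V :=
  code_fun (@proj1_sig _ _) (code_set code_tree) P.

Definition code_multitree theta (tau : multitree theta) : V :=
  code_fun (@code_index theta) code_tree tau.

Definition code_system (phi : system) : V :=
  setof [set z | exists s T,
           phi s = Some T /\ z = opair (code_string s) (code_tree T)].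

Definition code_multisystem theta (Phi : multisystem theta) : V :=
  code_fun (@code_index theta) code_system Phi.

Definition code_rname theta (c : rname theta) : V :=
  code_fun (fun ni : nat * bool => opair (vnat ni.1) (vnat ni.2))
    (code_set (@code_multitree theta)) c.

Definition generic_sequence (M : set V) theta (P : below theta -> set tree)
    (Phi : nat -> multisystem theta) : Prop :=
  [/\ forall j, MS P (Phi j),
      forall j, ms_le (Phi j) (Phi j.+1)
    & forall D, ms_dense P D -> M (code_set (@code_multisystem theta) D) ->
        exists j, D (Phi j)].

(** For an increasing sequence [Phi] at most one tree [T] occurs as
    [Phi j p s = Some T], so the union is that tree. *)
Definition limit_tree theta (Phi : nat -> multisystem theta)
    (p : index theta) (s : seq bool) : tree :=
  \bigcup_(T in [set T | exists j, Phi j p s = Some T]) T.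

Definition fusion_tree theta (Phi : nat -> multisystem theta)
    (p : index theta) (s : seq bool) : tree :=
  \bigcap_(n in [set n | size s <= n])
    \bigcup_(t in [set t | size t = n /\ prefix s t]) limit_tree Phi p t.

Definition fusion_family theta (Phi : nat -> multisystem theta) :
    below theta -> set tree :=
  fun xi => [set U | exists m s, U = fusion_tree Phi (xi, m) s].

(* Main.v *)
(** Let [U] be the fusion tree [U^{eta m0}_{u0}].  Every node of a level of the
    system [(eta, m0)] can be made the value of a coordinate [(eta, k)] of a
    multitree, so density of the sets [D(k)], applied to these finitely many [k],
    shrinks the trees of that level until a string [s] that is decided to be an
    initial part of [c] lies in none of them; the new coordinates of the support
    are absorbed by fresh systems.  Hence the multisystems witnessing such an [s],
    compatibly with [nu], are dense, and genericity yields the result.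

    The dense set must belong to the model.  Its definition avoids the
    second-order notion of direct forcing: the value [c(n) = i] is witnessed by a
    single [sigma] in [C^i_n] above the multitree.  Every definable closure of a
    set of the model under a binary function is again a set of the model, by
    recursion along [omega] and Replacement; this provides the strings, the finite
    systems and the multisystems without Power Set, and Separation does the rest. *)

From HB Require Import structures.
Require Import Defs.
From mathcomp Require Import all_boot.
From mathcomp Require Import boolp classical_sets functions cardinality.

Set Implicit Arguments.
Unset Strict Implicit.
Unset Printing Implicit Defensive.

Local Open Scope classical_set_scope.

(** The components of [nu] taken from the fusion family are built from the generic sequence and need
    not belong to the model. The model sees them through an assignment, a finite map from
    coordinates to nodes of systems, recording that the coordinate carries the fusion tree at that
    node. Passing to a longer node is harmless, since fusion trees decrease along nodes. The
    difficulty is that a multitree shrinks its coordinates independently, while a system has one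
    tree per node; coordinates with equal or comparable nodes are therefore moved beforehand to
    pairwise incomparable longer nodes. Conversely, [s] lies outside a root fusion tree exactly when
    some whole level omits it, so each node of that level needs a coordinate of its own. The
    hypothesis on [D(k)] allows finite covers, whereas the dense set uses a single [sigma]. The two
    are reconciled because a multitree whose body is covered by finitely many multitrees is
    compatible with one of them. Where [P xi] is empty, all systems and fusion trees over it are
    empty; such components of [nu] are left as they are. *)

Lemma finite_set_ind (T : Type) (Q : set T -> Prop) :
  Q set0 ->
  (forall A x, finite_set A -> Q A -> Q (x |` A)) ->
  forall A, finite_set A -> Q A.
Proof.
move=> Q0 QS A.
pose T' : eqType := HB.pack T (gen_eqMixin T).
move=> /(@finite_seqP T')[s ->]; elim: s => [|x s IHs].
  by have -> : [set` [::]] = set0 :> set T' by apply/seteqP; split.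
have -> : [set` x :: s] = x |` [set` s] :> set T'.
  apply/predeqP => y; rewrite mksetE in_cons; split=> [/orP[/eqP|]|[->|]].
  - by left.
  - by right.
  - by rewrite eqxx.
  - by move=> ->; rewrite orbT.
by apply: QS => //; apply/(@finite_seqP T'); exists s.
Qed.

Lemma finite_set_bound (T : Type) (A : set T) (f : T -> nat) :
  finite_set A -> exists n, forall x, A x -> f x < n.
Proof.
move: A; apply: finite_set_ind => [|A x _ [n An]]; first by exists 0.
exists (maxn n (f x).+1) => y [->|/An yn]; first exact: leq_maxr.
exact: leq_trans yn (leq_maxl _ _).
Qed.

(** * Sets of [V]: ranges, images, unions, pairs and power sets *)

Definition is_set (A : set V) : Prop := exists x, elts x = A.

Lemma elts_inj : injective elts.
Proof. exact: V_ext. Qed.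

Lemma elts_setof A : is_set A -> elts (setof A) = A.
Proof. exact: setofP. Qed.

Lemma setof_elts x : setof (elts x) = x.
Proof. by apply: V_ext; apply: elts_setof; exists x. Qed.

Lemma vmem_ind (Q : V -> Prop) :
  (forall x, (forall y, vmem y x -> Q y) -> Q x) -> forall x, Q x.
Proof.
move=> QI x; have [p ->] := vclassP x; elim: p => A f IH.
by apply: QI => y /vmem_vclass[a ->].
Qed.

Lemma elts_range x : exists (A : Type) (f : A -> V), elts x = range f.
Proof.
have [[A f] ->] := vclassP x; exists A, (fun a => vclass (f a)).
apply/predeqP => y; split=> [/vmem_vclass[a ->]|[a _ <-]]; first by exists a.
by apply/vmem_vclass; exists a.
Qed.

Lemma is_set_range (I : Type) (f : I -> V) : is_set (range f).
Proof. by exists (setof (range f)); exact: setof_range. Qed.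

Lemma is_set_sub (A : set V) x : A `<=` elts x -> is_set A.
Proof.
have [I [f ->]] := elts_range x => Af.
exists (setof (range (fun i : {i | A (f i)} => f (projT1 i)))).
rewrite setof_range; apply/predeqP => y; split=> [[[i Ai] _ <-] //|Ay].
by have [i _ iy] := Af y Ay; rewrite -iy in Ay *; exists (exist _ i Ay).
Qed.

Lemma is_set_image x (f : V -> V) : is_set (f @` elts x).
Proof.
have [I [g ->]] := elts_range x.
by rewrite image_comp; exact: is_set_range.
Qed.

(** Types such as [{y | vmem y x}] live in the universe of [V], above the index types of [Sup]. A
    range over them is a set because a type of the lower universe maps onto them. *)
Definition small (T : Type) : Prop :=
  exists (I : Type) (g : I -> T), forall t, exists i, g i = t.

Lemma small_range (T : Type) (f : T -> V) : small T -> is_set (range f).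
Proof.
move=> [I [g gE]]; have -> : range f = range (f \o g); last exact: is_set_range.
apply/predeqP => x; split=> [[t _ <-]|[i _ <-]]; last by exists (g i).
by have [i <-] := gE t; exists i.
Qed.

Lemma small_elts x : small {y | vmem y x}.
Proof.
have [I [g gE]] := elts_range x.
have hg i : vmem (g i) x by change (elts x (g i)); rewrite gE; exists i.
exists I, (fun i => exist _ (g i) (hg i)) => -[y xy].
have : elts x y by [].
by rewrite gE => -[i _ iy]; exists i; exact: eq_exist.
Qed.

Lemma small_prod (T U : Type) : small T -> small U -> small (T * U).
Proof.
move=> [I [g gE]] [J [h hE]]; exists (I * J)%type, (fun p => (g p.1, h p.2)).
by move=> [t u]; have [i <-] := gE t; have [j <-] := hE u; exists (i, j).
Qed.

Lemma small_type (T : Set) : small T.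
Proof. by exists T, id => t; exists t. Qed.

Lemma is_setU x y : is_set (elts x `|` elts y).
Proof.
have [I [f ->]] := elts_range x; have [J [g ->]] := elts_range y.
have -> : range f `|` range g =
  range (fun k : I + J => match k with inl i => f i | inr j => g j end).
  apply/predeqP => z; split=> [[[i _ <-]|[j _ <-]]|[[i|j] _ <-]].
  - by exists (inl i).
  - by exists (inr j).
  - by left; exists i.
  - by right; exists j.
exact: is_set_range.
Qed.

Lemma is_set1 x : is_set [set x].
Proof.
have -> : [set x] = range (fun _ : unit => x); last exact: is_set_range.
by apply/predeqP => z; split=> [->|[_ _ <-]] //; exists tt.
Qed.

Lemma is_set0 : is_set set0.
Proof. by apply: (@is_set_sub _ (setof set0)). Qed.

Lemma elts0 : elts (setof set0) = set0.
Proof. exact: elts_setof is_set0. Qed.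

Lemma elts1 x : elts (setof [set x]) = [set x].
Proof. exact: elts_setof (is_set1 x). Qed.

Lemma is_set2 x y : is_set [set x; y].
Proof. by have := is_setU (setof [set x]) (setof [set y]); rewrite !elts1. Qed.

Lemma elts2 x y : elts (setof [set x; y]) = [set x; y].
Proof. exact: elts_setof (is_set2 x y). Qed.

Lemma set1_inj (x y : V) : [set x] = [set y] -> x = y.
Proof. by move=> /predeqP/(_ x)[+ _]; apply. Qed.

Lemma opair_inj a b c d : opair a b = opair c d -> a = c /\ b = d.
Proof.
move=> /(congr1 elts); rewrite /opair !elts2.
set A := setof [set a]; set B := setof [set a; b].
set C := setof [set c]; set D := setof [set c; d] => /predeqP e.
have AC x y : setof [set x] = setof [set y] -> x = y.
  by move/(congr1 elts); rewrite !elts1; exact: set1_inj.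
have BC x y z : setof [set x; y] = setof [set z] -> x = z /\ y = z.
  move/(congr1 elts); rewrite elts1 elts2 => /predeqP h.
  by split; apply/h; [left|right].
have ac : a = c.
  have [/(_ (or_introl erefl)) + _] := e A.
  case=> [/AC //|/esym/BC[-> _] //].
split=> //; move: e; rewrite {}/A {}/B {}/C {}/D -{}ac => e.
have [/(_ (or_intror erefl)) + _] := e (setof [set a; b]).
case=> [/BC[_ ba]|/(congr1 elts)].
  have [_ /(_ (or_intror erefl))] := e (setof [set a; d]).
  rewrite ba; case=> [/BC[_ ->] //|/(congr1 elts)].
  by rewrite !elts2 => /predeqP/(_ d)[/(_ (or_intror erefl))[->|->]].
rewrite !elts2 => /predeqP h; have [/(_ (or_intror erefl))[ba|//] _] := h b.
by have [_ /(_ (or_intror erefl))[->|->]] := h d.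
Qed.

(** The predicates on an index type form an index type again. *)
Lemma is_set_powerset x : is_set [set y | elts y `<=` elts x].
Proof.
have [I [f fE]] := elts_range x.
have -> : [set y | elts y `<=` elts x] =
  range (fun Q : I -> Prop => setof (f @` [set i | Q i])).
  have sQ (Q : I -> Prop) : elts (setof (f @` [set i | Q i])) = f @` [set i | Q i].
    apply: elts_setof; apply: (@is_set_sub _ x).
    by rewrite fE => y [i _ <-]; exists i.
  apply/predeqP => y; split=> [/= yx|[Q _ <-] /=]; last first.
    by rewrite sQ fE => z [i _ <-]; exists i.
  exists (fun i => vmem (f i) y) => //; apply: V_ext; rewrite sQ.
  apply/predeqP => z; split=> [[i iy <-] //|zy].
  have := yx z zy; rewrite fE => -[i _ iz]; exists i => //=; by rewrite iz.
exact: is_set_range.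
Qed.

Lemma is_set_bounded (A : set V) x :
  (forall y, A y -> elts y `<=` elts x) -> is_set A.
Proof.
by move=> Ax; have [z zE] := is_set_powerset x; apply: (@is_set_sub _ z); rewrite zE.
Qed.

(** * Definability over a transitive model *)

Fixpoint frename (f : nat -> nat) (phi : formula) : formula :=
  match phi with
  | FMem i j => FMem (f i) (f j)
  | FEq i j => FEq (f i) (f j)
  | FNot phi => FNot (frename f phi)
  | FImp phi psi => FImp (frename f phi) (frename f psi)
  | FAll phi => FAll (frename (fun n => if n is m.+1 then (f m).+1 else 0) phi)
  end.

Lemma holds_ext (D : Type) (E : D -> D -> Prop) phi (e e' : nat -> D) :
  (forall n, e n = e' n) -> holds E e phi <-> holds E e' phi.
Proof. by move=> /funext ->. Qed.

Lemma holds_frename (D : Type) (E : D -> D -> Prop) phi f (e : nat -> D) :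
  holds E e (frename f phi) <-> holds E (e \o f) phi.
Proof.
elim: phi f e => [//|//|phi IH|phi IH psi IH'|phi IH] f e /=.
- by rewrite IH.
- by rewrite IH IH'.
- split=> h x; have := h x; rewrite IH; apply: (iffLR (holds_ext _ _ _));
  by case.
Qed.

(** Arguments and parameters share the variables by parity. Both supplies are unlimited, so no bound
    on the free variables of a formula has to be carried. *)
Definition interleave (D : Type) (e p : nat -> D) (n : nat) : D :=
  if odd n then p n./2 else e n./2.

Lemma interleave_even (D : Type) (e p : nat -> D) n : interleave e p n.*2 = e n.
Proof. by rewrite /interleave odd_double doubleK. Qed.

Lemma interleave_odd (D : Type) (e p : nat -> D) n : interleave e p n.*2.+1 = p n.
Proof. by rewrite /interleave /= odd_double /= uphalf_double. Qed.

Section Model.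
Variables (M : set V) (hM : countable_transitive_model M).

Local Notation D := {x : V | M x}.
Local Notation E := (fun x y : D => vmem (proj1_sig x) (proj1_sig y)).

Lemma model_trans x y : M x -> vmem y x -> M y.
Proof. by case: hM => _ + _; exact. Qed.

Definition env_in (e : nat -> V) : Prop := forall n, M (e n).

(* The even variables of [phi] are the arguments, the odd ones parameters. *)
Definition definable (R : (nat -> V) -> Prop) : Prop :=
  exists (phi : formula) (p : nat -> D), forall e : nat -> D,
    holds E (interleave e p) phi <-> R (fun n => proj1_sig (e n)).

Definition definable_fun (t : (nat -> V) -> V) : Prop :=
  (forall e, env_in e -> M (t e)) /\
  definable (fun e => e 0 = t (fun n => e n.+1)).

Lemma definable_ext R R' : (forall e, env_in e -> R e <-> R' e) ->
  definable R -> definable R'.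
Proof.
move=> RR' [phi [p h]]; exists phi, p => e; rewrite h; apply: RR' => n.
exact: (proj2_sig (e n)).
Qed.

Lemma definable_rename f R : definable R -> definable (fun e => R (e \o f)).
Proof.
move=> [phi [p h]].
exists (frename (fun n => if odd n then n else (f n./2).*2) phi), p => e.
rewrite holds_frename -(h (e \o f)); apply: holds_ext => n.
rewrite /= {2}/interleave; case: ifPn => [on|_]; last exact: interleave_even.
by rewrite /interleave on.
Qed.

Lemma definable_not R : definable R -> definable (fun e => ~ R e).
Proof. by move=> [phi [p h]]; exists (FNot phi), p => e /=; rewrite h. Qed.

Lemma definable_imp R R' : definable R -> definable R' ->
  definable (fun e => R e -> R' e).
Proof.
move=> [phi [p h]] [phi' [p' h']].
(* The two parameter sequences are interleaved once more: parameter [k] of the first formula becomes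
   number [2k], that of the second number [2k+1]. The renamings move the odd variables
   accordingly. *)
pose f n := if odd n then n./2.*2.*2.+1 else n.
pose f' n := if odd n then n./2.*2.+1.*2.+1 else n.
exists (FImp (frename f phi) (frename f' phi')), (interleave p p') => e /=.
rewrite !holds_frename -h -h'.
have -> : interleave e (interleave p p') \o f = interleave e p.
  apply/funext => n; rewrite /= /f [RHS]/interleave; case: ifPn => on.
    by rewrite interleave_odd interleave_even.
  by rewrite /interleave (negPf on).
suff -> : interleave e (interleave p p') \o f' = interleave e p' by [].
apply/funext => n; rewrite /= /f' [RHS]/interleave; case: ifPn => on.
  by rewrite !interleave_odd.
by rewrite /interleave (negPf on).
Qed.

(** A quantifier puts its value in front of the whole interleaved sequence, whereas it should extend
    the arguments alone. So a parameter is found one place later, and the argument variable [2k+2]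
    at place [2k+1]. *)
Let pull1 n := if odd n then n.+1 else n.-1.

Lemma interleave_scons (D' : Type) (x : D') e p n :
  scons x (interleave e p) (pull1 n) = interleave (scons x e) p n.
Proof.
rewrite /pull1 {2}/interleave; case: ifPn => on.
  by rewrite /= /interleave on.
case: n on => [//|[//|n]] /=; rewrite negbK => on.
by rewrite /interleave (negPf on).
Qed.

Lemma definable_all (R : V -> (nat -> V) -> Prop) :
  definable (fun e => R (e 0) (fun n => e n.+1)) ->
  definable (fun e => forall x, M x -> R x e).
Proof.
move=> [phi [p h]]; exists (FAll (frename pull1 phi)), p => e /=.
split=> H x; last first.
  rewrite holds_frename.
  apply: (iffRL (holds_ext _ _ _)); first exact: interleave_scons.
  by apply/h; apply: H; exact: (proj2_sig x).
move=> Mx; have := H (exist _ x Mx).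
rewrite holds_frename => /(iffLR (holds_ext _ _ (interleave_scons _ _ _))).
by rewrite h.
Qed.

Lemma definable_varmem i j : definable (fun e => vmem (e i) (e j)).
Proof.
have [_ _ [_ [[w _] _ _ _ _]]] := hM.
by exists (FMem i.*2 j.*2), (fun _ => w) => e /=; rewrite !interleave_even.
Qed.

Lemma sig_val_inj (x y : D) : proj1_sig x = proj1_sig y -> x = y.
Proof. by case: x y => [x Mx] [y My] /= xy; exact: eq_exist. Qed.

Lemma definable_vareq i j : definable (fun e => e i = e j).
Proof.
have [_ _ [_ [[w _] _ _ _ _]]] := hM.
exists (FEq i.*2 j.*2), (fun _ => w) => e /=; rewrite !interleave_even.
by split=> [->//|]; exact: sig_val_inj.
Qed.

Lemma definable_eqconst i a : M a -> definable (fun e => e i = a).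
Proof.
move=> Ma; exists (FEq i.*2 1), (fun _ => exist _ a Ma) => e /=.
by rewrite interleave_even; split=> [->//|h]; apply: sig_val_inj.
Qed.

Lemma definable_and R R' : definable R -> definable R' ->
  definable (fun e => R e /\ R' e).
Proof.
move=> dR dR'.
apply: definable_ext (definable_not (definable_imp dR (definable_not dR'))).
by move=> e _; rewrite not_implyE notK.
Qed.

Lemma definable_or R R' : definable R -> definable R' ->
  definable (fun e => R e \/ R' e).
Proof.
move=> dR dR'; apply: definable_ext (definable_imp (definable_not dR) dR').
by move=> e _; rewrite implyE notK.
Qed.

Lemma definable_iff R R' : definable R -> definable R' ->
  definable (fun e => R e <-> R' e).
Proof. by move=> dR dR'; apply: definable_and; exact: definable_imp. Qed.

Lemma definable_ex (R : V -> (nat -> V) -> Prop) :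
  definable (fun e => R (e 0) (fun n => e n.+1)) ->
  definable (fun e => exists2 x, M x & R x e).
Proof.
move=> /definable_not dR.
apply: definable_ext (definable_not (definable_all
  (R := fun x e => ~ R x e) dR)) => e _.
split=> [h|[x Mx Rx] h]; last exact: h Rx.
by apply: contrapT => h'; apply: h => x Mx Rx; apply: h'; exists x.
Qed.

(** Substitution is expressed by quantifying over the value of the term, which lies in [M]. *)
Lemma definable_subst t (R : V -> (nat -> V) -> Prop) : definable_fun t ->
  definable (fun e => R (e 0) (fun n => e n.+1)) ->
  definable (fun e => R (t e) e).
Proof.
move=> [Mt dt] dR.
apply: definable_ext (definable_ex
  (R := fun x e => x = t e /\ R x e) (definable_and dt dR)) => e Me.
by split=> [[x _ [-> //]]|Rt]; exists (t e) => //; exact: Mt.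
Qed.

Lemma definable_fun_shift t : definable_fun t ->
  definable_fun (fun e => t (fun n => e n.+1)).
Proof.
move=> [Mt dt]; split=> [e Me|]; first by apply: Mt => n.
exact: (definable_rename (fun n => if n is m.+1 then m.+2 else 0) dt).
Qed.

Lemma definable_fun_shift1 t : definable_fun t ->
  definable_fun (fun e => t (fun n => if n is m.+1 then e m.+2 else e 0)).
Proof.
move=> [Mt dt]; split=> [e Me|]; first by apply: Mt => -[].
apply: definable_ext (definable_rename
   (fun n => if n is m.+1 then (if m is k.+1 then k.+3 else 1) else 0) dt).
move=> e _ /=.
suff -> : (fun n => (e \o (fun n => match n with
  0 => 0 | m.+1 => match m with 0 => 1 | k.+1 => k.+3 end end)) n.+1) =
  (fun n => if n is m.+1 then e m.+3 else e 1) by [].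
by apply/funext => -[].
Qed.

Lemma definable_mem t t' : definable_fun t -> definable_fun t' ->
  definable (fun e => vmem (t e) (t' e)).
Proof.
move=> dt dt'; apply: (definable_subst (R := fun x e => vmem x (t' e)) dt).
apply: (definable_subst (R := fun y e => vmem (e 0) y)).
  exact: definable_fun_shift.
exact: definable_varmem.
Qed.

Lemma definable_eq t t' : definable_fun t -> definable_fun t' ->
  definable (fun e => t e = t' e).
Proof.
move=> dt dt'; apply: (definable_subst (R := fun x e => x = t' e) dt).
by case: dt'.
Qed.

Lemma definable_fun_var i : definable_fun (fun e => e i).
Proof. by split; [move=> e; exact | exact: definable_vareq]. Qed.

Lemma definable_fun_const a : M a -> definable_fun (fun _ => a).
Proof. by move=> Ma; split=> //; exact: definable_eqconst. Qed.

Lemma definable_ball t (R : V -> (nat -> V) -> Prop) : definable_fun t ->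
  definable (fun e => R (e 0) (fun n => e n.+1)) ->
  definable (fun e => forall x, vmem x (t e) -> R x e).
Proof.
move=> dt dR.
apply: definable_ext (definable_all
  (R := fun x e => vmem x (t e) -> R x e) _) => [e Me|]; last first.
  apply: definable_imp => //; apply: definable_mem.
    exact: definable_fun_var.
  exact: definable_fun_shift.
split=> h x; last by move=> _; exact: h.
by move=> xt; apply: h => //; apply: model_trans xt; case: dt => + _; exact.
Qed.

Lemma definable_bex t (R : V -> (nat -> V) -> Prop) : definable_fun t ->
  definable (fun e => R (e 0) (fun n => e n.+1)) ->
  definable (fun e => exists2 x, vmem x (t e) & R x e).
Proof.
move=> dt dR.
apply: definable_ext (definable_ex
  (R := fun x e => vmem x (t e) /\ R x e) _) => [e Me|]; last first.
  apply: definable_and => //; apply: definable_mem.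
    exact: definable_fun_var.
  exact: definable_fun_shift.
split=> [[x _ [xt Rx]]|[x xt Rx]]; first by exists x.
by exists x => //; apply: model_trans xt; case: dt => + _; exact.
Qed.

Lemma model_separation (R : V -> (nat -> V) -> Prop) e a : env_in e -> M a ->
  definable (fun e => R (e 0) (fun n => e n.+1)) ->
  exists2 b, M b & elts b = [set x | vmem x a /\ R x e].
Proof.
move=> Me Ma [phi [p h]].
have [_ _ [_ [_ sep _ _ _]]] := hM.
pose e' n : D := exist _ (e n) (Me n).
have [[b Mb] /= bE] := sep (frename pull1 phi) (interleave e' p) (exist _ a Ma).
have eqv (x : D) : holds E (scons x (interleave e' p)) (frename pull1 phi) <->
    R (proj1_sig x) e.
  rewrite holds_frename.
  rewrite (holds_ext _ _ (interleave_scons x e' p)) h /=.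
  by suff -> : (fun n => e n) = e by [].
exists b => //; apply/predeqP => x; split=> [xb|[/= xa Rx]].
  have Mx : M x by exact: model_trans xb.
  by have [+ _] := bE (exist _ x Mx) => /(_ xb)[/= xa /eqv].
have Mx : M x by exact: model_trans xa.
by apply: (iffRL (bE (exist _ x Mx))); split=> //; apply/eqv.
Qed.

(** The analogue of [pull1] for two new values, which become the argument variables [0] and [2]. *)
Let pull2 n := if odd n then n.+2 else if n is 2 then 1 else n.-2.

Lemma interleave_scons2 (D' : Type) (x y : D') e p n :
  scons x (scons y (interleave e p)) (pull2 n) =
  interleave (scons x (scons y e)) p n.
Proof.
rewrite /pull2 {2}/interleave; case: ifPn => on.
  by rewrite /= /interleave on.
case: n on => [//|[//|[//|[//|n]]]] /=; rewrite !negbK => on.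
by rewrite /interleave /= (negPf on).
Qed.

Lemma model_replacement (R : V -> V -> (nat -> V) -> Prop) e a :
  env_in e -> M a ->
  definable (fun e => R (e 0) (e 1) (fun n => e n.+2)) ->
  (forall x y z, vmem x a -> M y -> M z -> R x y e -> R x z e -> y = z) ->
  exists2 b, M b & elts b = [set y | M y /\ exists2 x, vmem x a & R x y e].
Proof.
move=> Me Ma [phi [p h]] Rf.
have [_ _ [_ [_ _ rep _ _]]] := hM.
pose e' n : D := exist _ (e n) (Me n).
have eqv (x y : D) :
    holds E (scons x (scons y (interleave e' p))) (frename pull2 phi) <->
    R (proj1_sig x) (proj1_sig y) e.
  rewrite holds_frename.
  rewrite (holds_ext _ _ (interleave_scons2 x y e' p)) h /=.
  by suff -> : (fun n => e n) = e by [].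
have [|[b Mb] /= bE] :=
    rep (frename pull2 phi) (interleave e' p) (exist _ a Ma).
  move=> x y z xa /eqv Rxy /eqv Rxz; apply: sig_val_inj.
  exact: (Rf _ _ _ xa (proj2_sig y) (proj2_sig z) Rxy Rxz).
exists b => //; apply/predeqP => y; split=> [yb|[My [x xa Rxy]]].
  have My : M y by exact: model_trans yb.
  have [+ _] := bE (exist _ y My) => /(_ yb)[x xa /eqv Rxy].
  by split=> //; exists (proj1_sig x).
have Mx : M x by exact: model_trans xa.
by apply: (iffRL (bE (exist _ y My))); exists (exist _ x Mx) => //; apply/eqv.
Qed.

(** By extensionality the graph says that a set has the required elements. It is enough to compare
    elements in [M], since [M] is transitive. *)
Lemma definable_fun_setof (A : (nat -> V) -> set V) :
  (forall e, env_in e -> exists2 z, M z & elts z = A e) ->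
  definable (fun e => A (fun n => e n.+1) (e 0)) ->
  definable_fun (fun e => setof (A e)).
Proof.
move=> hA dA; have AE e : env_in e -> M (setof (A e)) /\ elts (setof (A e)) = A e.
  by move=> /hA[z Mz zA]; rewrite -zA setof_elts.
split=> [e /AE[]//|].
apply: definable_ext (definable_all
  (R := fun x e => vmem x (e 0) <-> A (fun n => e n.+1) x) _) => [e Me|]; last first.
  apply: definable_iff; first exact: definable_varmem.
  exact: (definable_rename (fun n => if n is m.+1 then m.+2 else 0) dA).
have Me' : env_in (fun n => e n.+1) by move=> n; exact: Me.
have [MA AE'] := AE _ Me'; split=> [h|-> x Mx]; last first.
  by change (elts (setof (A (fun n => e n.+1))) x <-> A (fun n => e n.+1) x); rewrite AE'.
apply: V_ext; rewrite AE'; apply/predeqP => x; split=> [xe|Ax].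
  by apply/h => //; exact: model_trans xe.
apply/h => //; apply: model_trans MA _.
by change (elts (setof (A (fun n => e n.+1))) x); rewrite AE'.
Qed.

Lemma definable_fun_sep t (R : V -> (nat -> V) -> Prop) : definable_fun t ->
  definable (fun e => R (e 0) (fun n => e n.+1)) ->
  definable_fun (fun e => setof [set x | vmem x (t e) /\ R x e]).
Proof.
move=> dt dR; apply: (definable_fun_setof (A := fun e => [set x | vmem x (t e) /\ R x e])).
  by move=> e Me; apply: model_separation => //; case: dt => + _; exact.
apply: definable_and => //; apply: definable_mem; first exact: definable_fun_var.
exact: definable_fun_shift.
Qed.

Lemma model_image t (f : V -> (nat -> V) -> V) e : definable_fun t -> env_in e ->
  definable_fun (fun e => f (e 0) (fun n => e n.+1)) ->
  exists2 b, M b & elts b = [set f x e | x in elts (t e)].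
Proof.
move=> [Mt dt] Me df.
have [|||b Mb bE] := model_replacement (R := fun x y e => y = f x e) (a := t e) Me.
- exact: Mt.
- apply: definable_eq; first exact: definable_fun_var.
  exact: (definable_fun_shift1 df).
- by move=> x y z _ _ _ -> ->.
exists b => //; rewrite bE; apply/predeqP => y.
split=> [[My [x xt ->]]|[x xt <-]]; first by exists x.
split; last by exists x.
apply: (proj1 df (scons x e)) => -[|n]; last exact: Me.
exact: model_trans (Mt _ Me) xt.
Qed.

Lemma definable_fun_image t (f : V -> (nat -> V) -> V) : definable_fun t ->
  definable_fun (fun e => f (e 0) (fun n => e n.+1)) ->
  definable_fun (fun e => setof [set f x e | x in elts (t e)]).
Proof.
move=> dt df; apply: (definable_fun_setof (A := fun e => [set f x e | x in elts (t e)])).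
  by move=> e Me; exact: model_image.
apply: definable_ext (definable_bex (t := fun e => t (fun n => e n.+1))
   (R := fun x e => f x (fun n => e n.+1) = e 0) _ _).
- by move=> e _; split=> [[x xt xe]|[x xt xe]]; exists x.
- exact: definable_fun_shift.
- apply: definable_eq (definable_fun_var 1); exact: (definable_fun_shift1 df).
Qed.

Lemma model_union x : M x ->
  exists2 u, M u & elts u = [set w | exists2 y, vmem w y & vmem y x].
Proof.
move=> Mx; have [_ _ [[_ _ _ un] _]] := hM.
have [[u Mu] /= uE] := un (exist _ x Mx).
exists u => //; apply/predeqP => w; split=> [wu|[y wy yx]].
  have Mw := model_trans Mu wu.
  by have [/(_ wu)[y wy yx] _] := uE (exist _ w Mw); exists (proj1_sig y).
have My := model_trans Mx yx; have Mw := model_trans My wy.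
by apply: (iffRL (uE (exist _ w Mw))); exists (exist _ y My).
Qed.

Definition vunion (x : V) : V := setof [set w | exists2 y, vmem y x & vmem w y].

Lemma elts_vunion x : M x ->
  elts (vunion x) = [set w | exists2 y, vmem y x & vmem w y].
Proof.
move=> /model_union[u _ uE]; apply: elts_setof; exists u; rewrite uE.
by apply/predeqP => w; split=> -[y]; exists y.
Qed.

Lemma definable_fun_union t : definable_fun t ->
  definable_fun (fun e => vunion (t e)).
Proof.
move=> dt; apply: (definable_fun_setof
  (A := fun e => [set w | exists2 y, vmem y (t e) & vmem w y])).
  move=> e Me; have [|u Mu uE] := @model_union (t e).
    by case: dt => + _; exact.
  by exists u => //; rewrite uE; apply/predeqP => w; split=> -[y]; exists y.
apply: (definable_bex (t := fun e => t (fun n => e n.+1))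
   (R := fun y e => vmem (e 0) y)); first exact: definable_fun_shift.
exact: definable_varmem.
Qed.

Lemma model_pair x y : M x -> M y -> M (setof [set x; y]).
Proof.
move=> Mx My; have [_ _ [[_ _ pr _] _]] := hM.
have [[z Mz] /= zE] := pr (exist _ x Mx) (exist _ y My).
suff <- : elts z = [set x; y] by rewrite setof_elts.
apply/predeqP => w; split=> [wz|].
  have Mw := model_trans Mz wz.
  have [/(_ wz) + _] := zE (exist _ w Mw).
  by case=> [/(congr1 (@proj1_sig _ _))|/(congr1 (@proj1_sig _ _))] /= ->; [left|right].
case=> ->; [apply: (iffRL (zE (exist _ x Mx)))|apply: (iffRL (zE (exist _ y My)))].
  by left.
by right.
Qed.

Lemma definable_fun_pair t t' : definable_fun t -> definable_fun t' ->
  definable_fun (fun e => setof [set t e; t' e]).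
Proof.
move=> dt dt'; apply: (definable_fun_setof (A := fun e => [set t e; t' e])).
  move=> e Me; exists (setof [set t e; t' e]); last exact: elts2.
  by apply: model_pair; [case: dt => + _|case: dt' => + _]; exact.
by apply: definable_or; [case: dt|case: dt'].
Qed.

Lemma definable_fun_single t : definable_fun t ->
  definable_fun (fun e => setof [set t e]).
Proof.
move=> dt; have := definable_fun_pair dt dt.
suff -> : (fun e => setof [set t e; t e]) = (fun e => setof [set t e]) by [].
by apply/funext => e; rewrite setUid.
Qed.

Lemma definable_fun_opair t t' : definable_fun t -> definable_fun t' ->
  definable_fun (fun e => opair (t e) (t' e)).
Proof.
move=> dt dt'; apply: definable_fun_pair; first exact: definable_fun_single.
exact: definable_fun_pair.
Qed.

Definition vcup (x y : V) : V := setof (elts x `|` elts y).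

Lemma elts_vcup x y : elts (vcup x y) = elts x `|` elts y.
Proof. exact: elts_setof (is_setU x y). Qed.

Lemma definable_fun_cup t t' : definable_fun t -> definable_fun t' ->
  definable_fun (fun e => vcup (t e) (t' e)).
Proof.
move=> dt dt'.
have := definable_fun_union (definable_fun_pair dt dt').
suff -> : (fun e => vunion (setof [set t e; t' e])) = (fun e => vcup (t e) (t' e)) by [].
apply/funext => e; congr setof; apply/predeqP => w.
have -> : vmem^~ (setof [set t e; t' e]) = [set t e; t' e] by exact: elts2.
by split=> [[y [->|->]]|[h|h]]; [left|right|exists (t e); first left|exists (t' e); first right].
Qed.

Lemma model_single x : M x -> M (setof [set x]).
Proof. by move=> Mx; have := model_pair Mx Mx; rewrite setUid. Qed.

Lemma model_opair x y : M x -> M y -> M (opair x y).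
Proof. by move=> Mx My; apply: model_pair; [exact: model_single|exact: model_pair]. Qed.

Lemma model_cup x y : M x -> M y -> M (vcup x y).
Proof.
move=> Mx My; exact: (proj1 (definable_fun_cup (definable_fun_const Mx)
  (definable_fun_const My)) (fun _ => x)).
Qed.

End Model.

(** * The natural numbers of [V] *)

Lemma vmem_asym x y : vmem x y -> ~ vmem y x.
Proof.
move: y; elim/vmem_ind: x => x IH y xy yx; exact: (IH _ yx _ yx xy).
Qed.

Definition vsucc (x : V) : V := vcup x (setof [set x]).

Lemma vmem_vsucc x y : vmem x (vsucc y) <-> vmem x y \/ x = y.
Proof.
change (elts (vsucc y) x <-> vmem x y \/ x = y).
by rewrite elts_vcup elts1.
Qed.

Lemma vsucc_inj : injective vsucc.
Proof.
move=> x y xy.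
have /vmem_vsucc[xy'|//] : vmem x (vsucc y) by rewrite -xy; apply/vmem_vsucc; right.
have /vmem_vsucc[yx'|//] : vmem y (vsucc x) by rewrite xy; apply/vmem_vsucc; right.
by case: (vmem_asym xy' yx').
Qed.

Lemma vnatS n : vnat n.+1 = vsucc (vnat n).
Proof. by rewrite /vsucc /vcup elts1. Qed.

Lemma vnat0 x : ~ vmem x (vnat 0).
Proof. by change (~ elts (setof set0) x); rewrite elts0. Qed.

Lemma vsucc_neq0 x : vsucc x <> vnat 0.
Proof. by move=> h; apply: (@vnat0 x); rewrite -h; apply/vmem_vsucc; right. Qed.

Lemma vnat_inj : injective vnat.
Proof.
elim=> [|n IH] [|m] //; rewrite !vnatS.
- by move/esym/vsucc_neq0.
- by move/vsucc_neq0.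
- by move/vsucc_inj/IH ->.
Qed.

Lemma vmem_vnat x n : vmem x (vnat n) <-> exists2 m, m < n & x = vnat m.
Proof.
elim: n => [|n IH]; first by split=> [/vnat0|[]].
rewrite vnatS vmem_vsucc IH; split=> [[[m mn ->]|->]|[m + ->]].
- by exists m => //; exact: ltnW.
- by exists n.
- by rewrite ltnS leq_eqVlt => /orP[/eqP ->|mn]; [right|left; exists m].
Qed.

(** Extension point of [definability], redefined when further terms have been shown definable. *)
Ltac definable_hook := fail.

(** Definability goals are syntax-directed: closure properties are applied until variables,
    constants and hypotheses remain. *)
Ltac definability :=
  match goal with hM : countable_transitive_model _ |- _ =>
  repeat (cbv beta; first
  [ eassumption
  | definable_hook
  | eapply (definable_fun_var hM)
  | eapply definable_fun_const; eassumption
  | eapply (definable_fun_opair hM)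
  | eapply (definable_fun_cup hM)
  | eapply (definable_fun_union hM)
  | eapply (definable_fun_single hM)
  | eapply (definable_fun_pair hM)
  | eapply (definable_fun_sep hM)
  | eapply (definable_fun_image hM)
  | eapply (definable_ball hM)
  | eapply (definable_bex hM)
  | eapply definable_all
  | eapply definable_ex
  | eapply definable_and
  | eapply (definable_or)
  | eapply definable_iff
  | eapply definable_not
  | eapply definable_imp
  | eapply (definable_mem hM)
  | eapply definable_eq ])
  end.

(** * Omega and recursion along it inside the model *)

Section Closure.
Variables (M : set V) (hM : countable_transitive_model M).

Lemma definable_fun_succ t : definable_fun M t ->
  definable_fun M (fun e => vsucc (t e)).
Proof. rewrite /vsucc => dt; definability. Qed.

Lemma model_vnat n : M (vnat n).
Proof.
elim: n => [|n IH].
  have [_ _ [_ [[[w Mw] [[[z Mz] /= zw z0] _]] _ _ _ _]]] := hM.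
  suff -> : setof set0 = z by [].
  apply: V_ext; rewrite elts0; apply/esym/predeqP => x; split=> // xz.
  exact: (z0 (exist _ x (model_trans hM Mz xz))).
have [MS _] := definable_fun_succ (definable_fun_const IH).
by rewrite vnatS; apply: (MS (fun _ => vnat n)) => _.
Qed.

(** Successors computed in [M] are true successors by transitivity. Minimality of the internal omega
    leaves only zero and successors in it, and membership induction then identifies every element
    with some [vnat n]. *)
Lemma model_omega : exists2 w, M w & elts w = range vnat.
Proof.
have [_ _ [_ [_ _ _ _ [[w Mw] [[/= [[z Mz] /= zw z0] wS] wmin] _]]]] := hM.
have z0' : z = vnat 0.
  apply: V_ext; rewrite elts0; apply/predeqP => x; split=> // xz.
  exact: (z0 (exist _ x (model_trans hM Mz xz))).
have w0 : vmem (vnat 0) w by rewrite -z0'.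
have wS' n : vmem n w -> vmem (vsucc n) w.
  move=> nw; have [[m Mm] /= mw mE] := wS (exist _ n (model_trans hM Mw nw)) nw.
  suff -> : vsucc n = m by [].
  apply: V_ext; apply/predeqP => x; rewrite /elts /= vmem_vsucc.
  split=> [xn|xm].
    have Mn := model_trans hM Mw nw.
    have Mx : M x by case: (xn) => [xn'|->] //; exact: (model_trans hM Mn xn').
    apply: (iffRL (mE (exist _ x Mx))); case: xn => [|xn]; first by left.
    by right; apply: sig_val_inj.
  have [/(_ xm) + _] := mE (exist _ x (model_trans hM Mm xm)).
  by case=> [|/(congr1 (@proj1_sig _ _))] /=; [left|right].
have M0 := model_vnat 0.
have [|v Mv vE] := model_separation hM (R := fun x _ => x = vnat 0 \/
    exists2 y, vmem y w & x = vsucc y) (e := fun _ => w) (a := w) (fun _ => Mw) Mw.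
  have := definable_fun_succ; move=> dS.
  definability; apply: dS; definability.
have wv x : vmem x w -> x = vnat 0 \/ exists2 y, vmem y w & x = vsucc y.
  move=> xw; suff : elts v x by rewrite vE => -[].
  have Mx := model_trans hM Mw xw.
  apply: (wmin (exist _ v Mv) _ (exist _ x Mx) xw); split.
    exists (exist _ (vnat 0) M0) => /=; last by move=> y /vnat0.
    by change (elts v (vnat 0)); rewrite vE; split=> //; left.
  move=> [n Mn] /= nv; have : elts v n by [].
  rewrite vE => -[nw _].
  have Sw := wS' _ nw; exists (exist _ (vsucc n) (model_trans hM Mw Sw)) => /=.
    by change (elts v (vsucc n)); rewrite vE; split=> //; right; exists n.
  move=> [y My] /=; rewrite vmem_vsucc; split=> -[]; [by left| |by left|].
    by move=> yn; right; apply: sig_val_inj.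
  by move/(congr1 (@proj1_sig _ _)); right.
exists w => //; apply/predeqP => x; split=> [|[n _ <-]].
  elim/vmem_ind: x => x IH xw; case: (wv x xw) => [->|[y yw xy]].
    by exists 0.
  have [|n _ ny] := IH y _ yw; first by rewrite xy; apply/vmem_vsucc; right.
  by exists n.+1 => //; rewrite vnatS ny.
by elim: n => [|n IH]; [exact: w0|rewrite vnatS; exact: wS'].
Qed.

Lemma model_iter (G : V -> V) x0 : M x0 -> definable_fun M (fun e => G (e 0)) ->
  exists2 b, M b & elts b = range (fun n => iter n G x0).
Proof.
move=> Mx0 dG; have MG x : M x -> M (G x).
  by move=> Mx; apply: (proj1 dG (fun _ => x)).
have Mi n : M (iter n G x0) by elim: n => //= n; exact: MG.
have M0 := model_vnat 0.
(* Finite approximations to the recursion: each pair of [f] is the initial one or is justified by a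
   pair of [f] one step earlier. Induction on [n] shows that such an [f] can have only the value
   [iter n G x0] at [vnat n]. *)
pose Q f := forall z, vmem z f -> z = opair (vnat 0) x0 \/
  exists2 i, M i & exists2 u, M u & vmem (opair i u) f /\ z = opair (vsucc i) (G u).
pose R n y (e : nat -> V) := exists2 f, M f & vmem (opair n y) f /\ Q f.
have dR : definable M (fun e => R (e 0) (e 1) (fun n => e n.+2)).
  rewrite /R /Q; have := definable_fun_succ => dS.
  have dG' i : definable_fun M (fun e => G (e i)).
    split=> [e Me|]; first exact: MG.
    exact: (definable_rename (fun n => if n is m.+1 then i.+1 else 0) (proj2 dG)).
  definability.
have RU n y e : R (vnat n) y e -> y = iter n G x0.
  move=> [f Mf []]; elim: n y => [|n IH] y ny Qf.
    case: (Qf _ ny) => [/opair_inj[_ //]|[i _ [u _ [_ /opair_inj[/esym/vsucc_neq0]]]]//].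
  case: (Qf _ ny) => [/opair_inj[+ _]|]; first by rewrite vnatS => /vsucc_neq0.
  move=> [i Mi' [u Mu [iu /opair_inj[]]]]; rewrite vnatS => /vsucc_inj ni ->.
  by rewrite -ni in iu; rewrite (IH _ iu Qf).
have RE n e : R (vnat n) (iter n G x0) e.
  elim: n => [|n [f Mf [nf Qf]]].
    exists (setof [set opair (vnat 0) x0]).
      by apply: (model_single hM); exact: (model_opair hM).
    split; first by rewrite -[vmem _ _]/(elts _ _) elts1.
    by move=> z; rewrite -[vmem _ _]/(elts _ z) elts1 => ->; left.
  have Mn := model_vnat n; have MSn := model_vnat n.+1.
  exists (vcup f (setof [set opair (vnat n.+1) (iter n.+1 G x0)])).
    apply: (model_cup hM) => //; apply: (model_single hM); exact: (model_opair hM).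
  split; first by rewrite -[vmem _ _]/(elts _ _) elts_vcup elts1; right.
  move=> z; rewrite -[vmem z _]/(elts _ z) elts_vcup elts1.
  have sub w : vmem w f -> vmem w (vcup f (setof [set opair (vnat n.+1) (iter n.+1 G x0)])).
    by move=> wf; rewrite -[vmem w _]/(elts _ w) elts_vcup; left.
  case=> [/Qf[->|[i Mi' [u Mu [iu ->]]]]|->]; first by left.
    by right; exists i => //; exists u => //; split=> //; exact: sub.
  right; exists (vnat n) => //; exists (iter n G x0) => //; split; first exact: sub.
  by rewrite vnatS.
have [w Mw wE] := model_omega.
have wP x : vmem x w -> exists n, x = vnat n.
  by rewrite -[vmem x w]/(elts w x) wE => -[n _ <-]; exists n.
have [|b Mb bE] := model_replacement hM (a := w) (e := fun _ => w) (fun _ => Mw) Mw dR.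
  by move=> x y z /wP[n ->] _ _ /RU -> /RU ->.
exists b => //; rewrite bE; apply/predeqP => y; split.
  by move=> [My [x /wP[n ->] /RU ->]]; exists n.
move=> [n _ <-]; split=> //; exists (vnat n); last exact: RE.
by rewrite -[vmem _ _]/(elts _ _) wE; exists n.
Qed.

Inductive generated (F : V -> V -> V) (X x0 : V) : set V :=
  | generated0 : generated F X x0 x0
  | generatedS a x : generated F X x0 a -> vmem x X -> generated F X x0 (F a x).

Lemma model_generated (F : V -> V -> V) X x0 : M X -> M x0 ->
  definable_fun M (fun e => F (e 0) (e 1)) ->
  exists2 b, M b & elts b = generated F X x0.
Proof.
move=> MX Mx0 dF.
have dF' i j : definable_fun M (fun e => F (e i) (e j)).
  split=> [e Me|]; first by apply: (proj1 dF (fun n => if n is 0 then e i else e j)) => -[].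
  exact: (definable_rename (fun n =>
    if n is m.+1 then (if m is 0 then i.+1 else j.+1) else 0) (proj2 dF)).
(* One simultaneous step of the closure: the [n]-th iterate from the singleton of [x0] holds the
   elements reached in exactly [n] steps. *)
pose G u := vunion (setof [set setof [set F a x | x in elts X] | a in elts u]).
have dG : definable_fun M (fun e => G (e 0)).
  rewrite /G; definability; exact: dF'.
pose Fimage a := setof [set F a x | x in elts X].
have FimageE a y : vmem y (Fimage a) <-> exists2 x, vmem x X & F a x = y.
  by rewrite -[vmem _ _]/(elts _ _) (elts_setof (is_set_image _ _)).
have GE u : M u ->
    elts (G u) = [set y | exists2 a, vmem a u & exists2 x, vmem x X & F a x = y].
  move=> Mu; have d : definable_fun M (fun e => setof [set Fimage a | a in elts (e 0)]).
    by definability; exact: dF'.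
  rewrite (elts_vunion hM); last exact: (proj1 d (fun _ => u)).
  have -> : vmem^~ (setof [set Fimage a | a in elts u]) = [set Fimage a | a in elts u].
    exact: elts_setof (is_set_image _ _).
  apply/predeqP => w; split=> [[_ [a au <-] /FimageE h]|[a au h]]; first by exists a.
  by exists (Fimage a); [exists a|exact/FimageE].
have Mi n : M (iter n G (setof [set x0])).
  elim: n => [|n IH] /=; first exact: (model_single hM).
  exact: (proj1 dG (fun _ => iter n G (setof [set x0]))).
have [b Mb bE] := model_iter (Mi 0) dG.
have [u Mu uE] := model_union hM Mb.
exists u => //; rewrite uE; apply/predeqP => w; split.
  move=> [y wy]; rewrite -[vmem y b]/(elts b y) bE => -[n _ ny].
  move: wy; rewrite -{}ny; elim: n w => [|n IH] w /=.
    by rewrite -[vmem w _]/(elts _ w) elts1 => ->; left.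
  rewrite -[vmem w _]/(elts _ w) (GE _ (Mi n)) => -[a an [x xX <-]].
  by right=> //; exact: IH.
elim=> [|a x _ [y ay yb] xX].
  exists (setof [set x0]); first by rewrite -[vmem x0 _]/(elts _ x0) elts1.
  by rewrite -[vmem _ b]/(elts b _) bE; exists 0.
move: yb; rewrite -[vmem y b]/(elts b y) bE => -[n _ ny].
exists (iter n.+1 G (setof [set x0])).
  rewrite /= -[vmem _ _]/(elts _ _) (GE _ (Mi n)); exists a; last by exists x.
  by rewrite ny.
by rewrite -[vmem _ b]/(elts b _) bE; exists n.+1.
Qed.

End Closure.

(** * Codes *)

Lemma vmem_setof A x : is_set A -> vmem x (setof A) <-> A x.
Proof. by move=> sA; rewrite -[vmem _ _]/(elts _ _) elts_setof. Qed.

Lemma vmem1 x y : vmem x (setof [set y]) <-> x = y.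
Proof. exact: vmem_setof (is_set1 y). Qed.

Lemma vmem_vcup x y z : vmem x (vcup y z) <-> vmem x y \/ vmem x z.
Proof. exact: vmem_setof (is_setU y z). Qed.

Lemma vmem_ext x y : (forall z, vmem z x <-> vmem z y) -> x = y.
Proof. by move=> h; apply: V_ext; apply/predeqP. Qed.

Lemma vmem_code_string z s : vmem z (code_string s) <->
  exists2 n, n < size s & z = opair (vnat n) (vnat (nth false s n)).
Proof.
rewrite vmem_setof; first by split=> [[n ns <-]|[n ns ->]]; exists n.
apply: (@is_set_sub _ (setof (range (fun n => opair (vnat n) (vnat (nth false s n)))))).
by rewrite setof_range => y [n _ <-]; exists n.
Qed.

Lemma mem_code_string n (i : bool) s :
  vmem (opair (vnat n) (vnat i)) (code_string s) <->
  n < size s /\ nth false s n = i.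
Proof.
rewrite vmem_code_string; split=> [[m ms /opair_inj[/vnat_inj -> /vnat_inj h]]|[ns <-]].
  by split=> //; move: h; case: i; case: (nth _ _ _).
by exists n.
Qed.

(** A string is coded by its graph, so formulas over [M] can express the prefix relation as
    inclusion. *)
Lemma code_string_sub s t :
  elts (code_string s) `<=` elts (code_string t) <-> prefix s t.
Proof.
split=> [st|/prefixP[u ->] z].
  have h n : n < size s -> n < size t /\ nth false t n = nth false s n.
    by move=> ns; apply/mem_code_string; apply: st; apply/mem_code_string.
  have st' : size s <= size t.
    by rewrite leqNgt; apply/negP => /h[]; rewrite ltnn.
  apply/prefixP; exists (drop (size s) t); rewrite -{1}(cat_take_drop (size s) t).
  congr (_ ++ _); apply: (@eq_from_nth _ false) => [|i]; first exact: size_takel.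
  by rewrite size_takel // => is'; rewrite nth_take //; have [_ ->] := h i is'.
rewrite -![elts _ _]/(vmem _ _) !vmem_code_string => -[n ns ->].
by exists n; rewrite ?nth_cat ?ns // size_cat ltn_addr.
Qed.

Lemma prefix_anti (s t : seq bool) : prefix s t -> prefix t s -> s = t.
Proof.
move=> /[dup] /prefixP[u ->] /size_prefix h1 /size_prefix.
by rewrite size_cat -{2}[size s]addn0 leq_add2l leqn0 size_eq0 => /eqP ->; rewrite cats0.
Qed.

Lemma code_string_inj : injective code_string.
Proof.
by move=> s t st; apply: prefix_anti; apply/code_string_sub; rewrite st.
Qed.

Lemma code_string_nil : code_string [::] = vnat 0.
Proof. by apply: vmem_ext => z; split=> [/vmem_code_string[]//|/vnat0]. Qed.

(** On the code of a string this is the length as a numeral, hence the position of the next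
    entry. *)
Definition vdom (x : V) : V := setof [set m | exists i, vmem (opair m i) x].

Lemma vdom_code_string s : vdom (code_string s) = vnat (size s).
Proof.
rewrite -[RHS]setof_elts; congr setof; apply/predeqP => m.
rewrite -[elts _ _]/(vmem _ _) vmem_vnat.
split=> [[i /vmem_code_string[n ns /opair_inj[-> _]]]|[n ns ->]].
  by exists n.
by exists (vnat (nth false s n)); apply/mem_code_string.
Qed.

Definition vrcons (s i : V) : V := vcup s (setof [set opair (vdom s) i]).

Lemma code_string_rcons s (i : bool) :
  vrcons (code_string s) (vnat i) = code_string (rcons s i).
Proof.
apply: vmem_ext => z; rewrite vmem_vcup vmem1 vdom_code_string !vmem_code_string.
rewrite size_rcons; split=> [[[n ns ->]|->]|[n]].
- by exists n; rewrite ?nth_rcons ?ns // ltnS ltnW.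
- by exists (size s); rewrite // nth_rcons ltnn eqxx.
- rewrite ltnS leq_eqVlt => /orP[/eqP -> ->|ns ->]; rewrite nth_rcons.
    by rewrite ltnn eqxx; right.
  by rewrite ns; left; exists n.
Qed.

Lemma vmem_code_tree z T : vmem z (code_tree T) <-> exists2 s, T s & z = code_string s.
Proof.
rewrite vmem_setof; first by split=> [[s Ts <-]|[s Ts ->]]; exists s.
apply: (@is_set_sub _ (setof (range code_string))).
by rewrite setof_range => y [n _ <-]; exists n.
Qed.

Lemma mem_code_tree s T : vmem (code_string s) (code_tree T) <-> T s.
Proof.
by rewrite vmem_code_tree; split=> [[t Tt /code_string_inj ->]//|Ts]; exists s.
Qed.

Lemma code_tree_sub T T' :
  (forall z, vmem z (code_tree T) -> vmem z (code_tree T')) <-> T `<=` T'.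
Proof.
split=> [h s Ts|h z /vmem_code_tree[s Ts ->]].
  by apply/mem_code_tree; apply: h; apply/mem_code_tree.
by apply/mem_code_tree; exact: h.
Qed.

Lemma code_tree_inj : injective code_tree.
Proof. by move=> T T' e; apply/seteqP; split; apply/code_tree_sub; rewrite e. Qed.

Lemma code_index_inj theta : injective (@code_index theta).
Proof.
move=> [[x xt] m] [[y yt] n] /opair_inj[/= xy /vnat_inj ->].
by congr pair; exact: eq_exist.
Qed.

Lemma small_index theta : small (Defs.index theta).
Proof. by apply: small_prod; [exact: small_elts|exact: small_type]. Qed.

Lemma vmem_code_fun (A B : Type) (cA : A -> V) (cB : B -> V) (f : A -> B) z :
  small A -> vmem z (code_fun cA cB f) <-> exists a, z = opair (cA a) (cB (f a)).
Proof.
move=> sA; rewrite vmem_setof; last exact: small_range.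
by split=> [[a _ <-]|[a ->]]; exists a.
Qed.

Lemma mem_code_fun (A B : Type) (cA : A -> V) (cB : B -> V) (f : A -> B) a y :
  small A -> injective cA ->
  vmem (opair (cA a) y) (code_fun cA cB f) <-> y = cB (f a).
Proof.
move=> sA icA; rewrite vmem_code_fun //.
by split=> [[b /opair_inj[/icA -> ->//]]|->]; exists a.
Qed.

Lemma vmem_code_set_tree z (Q : set tree) :
  vmem z (code_set code_tree Q) <-> exists2 T, Q T & z = code_tree T.
Proof.
rewrite vmem_setof; first by split=> [[s Ts <-]|[s Ts ->]]; exists s.
apply: (@is_set_bounded _ (setof (range code_string))) => y [T _ <-] w.
rewrite setof_range -[elts _ _]/(vmem _ _) => /vmem_code_tree[s _ ->].
by exists s.
Qed.

Lemma mem_code_set_tree T (Q : set tree) :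
  vmem (code_tree T) (code_set code_tree Q) <-> Q T.
Proof.
rewrite vmem_code_set_tree.
by split=> [[T' QT' /code_tree_inj ->]//|QT]; exists T.
Qed.

Lemma small_tree : small tree.
Proof. by exists (seq bool -> Prop), id => t; exists t. Qed.

Lemma vmem_code_set_multitree theta z (C : set (multitree theta)) :
  vmem z (code_set (@code_multitree theta) C) <->
  exists2 sigma, C sigma & z = code_multitree sigma.
Proof.
rewrite vmem_setof; first by split=> [[s Ts <-]|[s Ts ->]]; exists s.
have /small_range sT := small_prod (small_index theta) small_tree.
have [x xE] := sT (fun pT => opair (code_index pT.1) (code_tree pT.2)).
apply: (@is_set_bounded _ x) => y [sigma _ <-] w.
rewrite xE -[elts _ _]/(vmem _ _) => /(vmem_code_fun _ _ _ _ (small_index theta))[p ->].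
by exists (p, sigma p).
Qed.

Lemma mem_code_rname theta (c : rname theta) n (i : bool) y :
  vmem (opair (opair (vnat n) (vnat i)) y) (code_rname c) <->
  y = code_set (@code_multitree theta) (c (n, i)).
Proof.
apply: (@mem_code_fun _ _ (fun ni : nat * bool => opair (vnat ni.1) (vnat ni.2))
  _ c (n, i)); first exact: small_type.
move=> [m j] [m' j'] /opair_inj[/= /vnat_inj -> /vnat_inj].
by case: j j' => -[].
Qed.

Lemma vmem_code_system z phi : vmem z (code_system phi) <->
  exists s T, phi s = Some T /\ z = opair (code_string s) (code_tree T).
Proof.
rewrite vmem_setof //.
have /small_range sT := small_prod (small_type (seq bool)) small_tree.
have [x xE] := sT (fun sT => opair (code_string sT.1) (code_tree sT.2)).
by apply: (@is_set_sub _ x); rewrite xE => _ [s [T [_ ->]]]; exists (s, T).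
Qed.

Lemma mem_code_system phi s y :
  vmem (opair (code_string s) y) (code_system phi) <->
  exists2 T, phi s = Some T & y = code_tree T.
Proof.
rewrite vmem_code_system; split=> [[t [T [tT /opair_inj[/code_string_inj -> ->]]]]|[T sT ->]].
  by exists T.
by exists s, T.
Qed.

Lemma mem_code_multisystem theta (Phi : multisystem theta) p y :
  vmem (opair (code_index p) y) (code_multisystem Phi) <-> y = code_system (Phi p).
Proof. exact: mem_code_fun (small_index theta) (@code_index_inj theta). Qed.

(** * Codes that belong to the model *)

Section ModelCodes.
Variables (M : set V) (hM : countable_transitive_model M).

Lemma model_opair_inv x y : M (opair x y) -> M x /\ M y.
Proof.
move=> Mxy; have M2 : M (setof [set x; y]).
  by apply: (model_trans hM Mxy); rewrite vmem_setof; [right|exact: is_set2].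
by split; apply: (model_trans hM M2); apply/vmem_setof;
  [exact: is_set2|left|exact: is_set2|right].
Qed.

Lemma definable_fun_dom t : definable_fun M t ->
  definable_fun M (fun e => vdom (t e)).
Proof.
move=> dt; apply: (definable_fun_setof hM
  (A := fun e => [set m | exists i, vmem (opair m i) (t e)])).
  move=> e Me; have Mt : M (t e) by case: dt => + _; exact.
  (* The first entry [m] of a pair satisfies [m] in [{m}] in the pair, so two unions reach all
     candidates and Separation applies. *)
  have [u Mu uE] := model_union hM Mt; have [w Mw wE] := model_union hM Mu.
  have [|v Mv vE] := model_separation hM (R := fun m e =>
      exists2 i, M i & vmem (opair m i) (t e)) Me Mw.
    have := definable_fun_shift dt => dt1.
    have := definable_fun_shift dt1 => dt2.
    definability.
  exists v => //; rewrite vE; apply/predeqP => m; split=> [[_ [i _ h]]|[i h]].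
    by exists i.
  have [Mm Mi] := model_opair_inv (model_trans hM Mt h).
  split; last by exists i.
  rewrite -[vmem _ _]/(elts _ _) wE; exists (setof [set m]); first exact/vmem1.
  rewrite -[vmem _ _]/(elts _ _) uE; exists (opair m i) => //.
  by rewrite vmem_setof; [left|exact: is_set2].
apply: (definable_ext (R := fun e => exists2 i, M i &
    vmem (opair (e 0) i) (t (fun n => e n.+1)))).
  move=> e Me; split=> [[i _ h]|[i h]]; first by exists i.
  exists i => //; have Mt : M (t (fun n => e n.+1)) by case: dt => + _; apply.
  by have [] := model_opair_inv (model_trans hM Mt h).
have := definable_fun_shift dt => dt1.
have := definable_fun_shift dt1 => dt2.
definability.
Qed.

Lemma definable_fun_rcons t t' : definable_fun M t -> definable_fun M t' ->
  definable_fun M (fun e => vrcons (t e) (t' e)).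
Proof.
move=> dt dt'; rewrite /vrcons; have dd := definable_fun_dom dt; definability.
Qed.

Lemma model_strings : exists2 S, M S & elts S = range code_string.
Proof.
have M2 := model_vnat hM 2; have M0 := model_vnat hM 0.
have [|b Mb bE] := model_generated hM (F := vrcons) M2 M0.
  by apply: definable_fun_rcons; definability.
exists b => //; rewrite bE; apply/predeqP => z; split.
  elim=> [|a x _ [s _ <-] /vmem_vnat[n n2 ->]].
    by exists [::] => //; exact: code_string_nil.
  exists (rcons s (n == 1)) => //; rewrite -code_string_rcons.
  by case: n n2 => [|[|]].
move=> [s _ <-]; elim/last_ind: s => [|s i IH].
  by rewrite code_string_nil; left.
rewrite -code_string_rcons; right=> //; apply/vmem_vnat; exists i => //.
by case: i.
Qed.

(** The product is the union of its slices; Replacement yields each slice as well as the set of all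
    slices. *)
Lemma model_prod x y : M x -> M y ->
  exists2 b, M b & elts b = [set z | exists2 u, vmem u x & exists2 v, vmem v y & z = opair u v].
Proof.
move=> Mx My.
have [|b Mb bE] := model_image hM (t := fun _ => x)
  (f := fun u _ => setof [set opair u v | v in elts y])
  (e := fun _ => x) (definable_fun_const Mx) (fun _ => Mx).
  definability.
have [u Mu uE] := model_union hM Mb.
exists u => //; rewrite uE; apply/predeqP => z; split.
  move=> [w zw]; rewrite -[vmem w b]/(elts b w) bE => -[a ax aw].
  move: zw; rewrite -aw vmem_setof; last exact: is_set_image.
  by move=> [v vy <-]; exists a => //; exists v.
move=> [a ax [v vy ->]]; exists (setof [set opair a v | v in elts y]).
  by rewrite vmem_setof; [exists v|exact: is_set_image].
by rewrite -[vmem _ b]/(elts b _) bE; exists a.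
Qed.

Lemma model_index theta : M theta ->
  exists2 b, M b & elts b = range (@code_index theta).
Proof.
move=> Mt; have [w Mw wE] := model_omega hM.
have [b Mb bE] := model_prod Mt Mw; exists b => //; rewrite bE.
apply/predeqP => z; split=> [[x xt [n]]|[[xi n] _ <-]].
  rewrite -[vmem n w]/(elts w n) wE => -[m _ <-] ->.
  by exists (exist _ x xt, m).
exists (proj1_sig xi); first exact: (proj2_sig xi).
by exists (vnat n) => //; rewrite -[vmem _ w]/(elts w _) wE; exists n.
Qed.

Lemma model_finite (A : set V) : finite_set A -> A `<=` M ->
  exists2 b, M b & elts b = A.
Proof.
move: A; apply: finite_set_ind => [_|A x _ IH xA].
  by exists (vnat 0); [exact: model_vnat|exact: elts0].
have [|b Mb bE] := IH; first by move=> y Ay; apply: xA; right.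
have Mx : M x by apply: xA; left.
exists (vcup b (setof [set x])).
  by apply: (model_cup hM) => //; exact: (model_single hM).
by rewrite elts_vcup elts1 bE setUC.
Qed.

End ModelCodes.

(** * Strings and stems *)

Lemma incomparable_split (s t : seq bool) : ~ comparable_str s t ->
  exists u i, prefix (rcons u i) s /\ prefix (rcons u (~~ i)) t.
Proof.
elim: s t => [|a s IH] [|b t] h.
- by case: h; left.
- by case: h; left.
- by case: h; right.
have [ab|ab] := eqVneq a b; last first.
  exists [::], a => /=; rewrite eqxx /= prefix0s; split=> //.
  by case: a b ab {h} => -[] //=; rewrite prefix0s.
subst b; have [|u [i [us ut]]] := IH t.
  by move=> st; apply: h; case: st => st; [left|right]; rewrite /= eqxx.
by exists (a :: u), i; rewrite /= eqxx us ut.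
Qed.

Lemma prefix_comparable (s t u : seq bool) :
  prefix s u -> prefix t u -> comparable_str s t.
Proof.
elim: u s t => [|x u IH] [|a s] [|b t] //=; try by left.
- by right.
- by move=> /andP[/eqP -> su] /andP[/eqP -> tu]; case: (IH _ _ su tu) => h;
    [left|right]; rewrite /= eqxx.
Qed.

Lemma prefix_incomparable (s t u : seq bool) (i : bool) :
  prefix (rcons u i) s -> prefix (rcons u (~~ i)) t -> ~ comparable_str s t.
Proof.
move=> us ut; have ne : ~ comparable_str (rcons u i) (rcons u (~~ i)).
  move=> [|] /prefixP[v] /(congr1 (fun x => nth false x (size u)));
  by rewrite nth_cat size_rcons ltnSn !nth_rcons ltnn eqxx; case: i {us ut}.
move=> [st|ts]; apply: ne.
  exact: (prefix_comparable (prefix_trans us st) ut).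
exact: (prefix_comparable us (prefix_trans ut ts)).
Qed.

(** A shortest splitting node [t] is the stem: an element incomparable with [t] would branch off at
    a shorter splitting node, and a proper extension of [t] cannot be comparable with both
    successors of [t]. *)
Lemma perfect_tree_splitting_stem T : perfect_tree T ->
  exists s, [/\ is_stem T s, T (rcons s false) & T (rcons s true)].
Proof.
move=> [treeT [s0 Ts0] splT].
pose spl t := T (rcons t false) /\ T (rcons t true).
have [n] : exists n, exists2 t, spl t & size t = n.
  by have [t [_ t0 t1]] := splT _ Ts0; exists (size t), t.
elim/ltn_ind: n => n IH [t [t0 t1] tn].
have [[u us un]|nu] := pselect (exists2 u, spl u & size u < n).
  by apply: (IH (size u)) => //; exists u.
exists t; split=> //; split=> [s Ts|s hs].
  apply: contrapT => /incomparable_split[u [i [ut us]]].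
  apply: nu; exists u; last by have := size_prefix ut; rewrite size_rcons tn.
  have Tui : T (rcons u i).
    by apply: treeT t0; apply: prefix_trans ut _; exact: prefix_rcons.
  have Tui' : T (rcons u (~~ i)) by exact: treeT us Ts.
  by case: i Tui Tui' {ut us}.
have Tt : T t by apply: treeT t0; exact: prefix_rcons.
case: (hs _ Tt) => [//|/prefixP[[|x v] sE]]; first by rewrite sE cats0 prefix_refl.
have Tx : T (rcons t (~~ x)) by case: x {sE}.
exfalso; apply: (@prefix_incomparable s (rcons t (~~ x)) t x _ _ (hs _ Tx)).
  by rewrite sE -cat_rcons prefix_prefix.
exact: prefix_refl.
Qed.

Lemma is_stem_uniq T s t : is_stem T s -> is_stem T t -> s = t.
Proof.
by move=> [hs ms] [ht mt]; apply: prefix_anti; [exact: mt|exact: ms].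
Qed.

Lemma stemE T s : is_stem T s -> stem T = s.
Proof.
move=> sT; apply: (is_stem_uniq _ sT).
exact: (xgetPex [::] (P := [set s | is_stem T s]) (ex_intro _ s sT)).
Qed.

Lemma perfect_tree_stem T : perfect_tree T -> is_stem T (stem T).
Proof. by move=> /perfect_tree_splitting_stem[s [sT _ _]]; rewrite (stemE sT). Qed.

Lemma perfect_tree_stem_split T i : perfect_tree T -> T (rcons (stem T) i).
Proof.
move=> /perfect_tree_splitting_stem[s [sT T0 T1]]; rewrite (stemE sT).
by case: i.
Qed.

Lemma finite_strings n : finite_set [set s : seq bool | size s < n].
Proof.
elim: n => [|n IH]; first by apply: (sub_finite_set _ (finite_set0 _)).
pose A := [set s : seq bool | size s < n].
apply: (@sub_finite_set _ _ ([set [::]] `|` (cons true @` A `|` cons false @` A))).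
  by move=> [|[] s] /= sn; [left|right; left; exists s|right; right; exists s].
by rewrite !finite_setU; split; [exact: finite_set1|split; exact: finite_image].
Qed.

Definition vsub (x y : V) : Prop := forall z, vmem z x -> vmem z y.

Definition vcomparable (s t : V) : Prop := vsub s t \/ vsub t s.

Lemma vcomparableP s t :
  vcomparable (code_string s) (code_string t) <-> comparable_str s t.
Proof. by split=> -[] h; [left|right|left|right]; apply/code_string_sub. Qed.

Ltac definable_hook ::=
  match goal with hM : countable_transitive_model _ |- _ =>
  first [ eapply (definable_fun_rcons hM) | eapply (definable_fun_dom hM)
    | eapply definable_fun_const; exact: (model_vnat hM) ]
  end.

(** * The set of multisystems in a model *)

Section Multisystems.
Variables (M : set V) (hM : countable_transitive_model M).
Variables (Str omega : V) (MStr : M Str) (StrE : elts Str = range code_string).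
Hypotheses (Momega : M omega) (omegaE : elts omega = range vnat).

Lemma mem_Str z : vmem z Str <-> exists s, z = code_string s.
Proof.
rewrite -[vmem _ _]/(elts _ _) StrE.
by split=> [[s _ <-]|[s ->]]; exists s.
Qed.

Lemma mem_omega z : vmem z omega <-> exists n, z = vnat n.
Proof.
rewrite -[vmem _ _]/(elts _ _) omegaE.
by split=> [[s _ <-]|[s ->]]; exists s.
Qed.

(** Since [stem] is a choice with a default value, formulas speak of the relation [is_stem]; a
    perfect tree has exactly one stem. *)
Definition vstem (T u : V) : Prop :=
  (forall t, vmem t T -> vcomparable u t) /\
  (forall s, vmem s Str -> (forall t, vmem t T -> vcomparable s t) -> vsub s u).

Lemma vstemP T u : vstem (code_tree T) (code_string u) <-> is_stem T u.
Proof.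
have h s : (forall t, vmem t (code_tree T) -> vcomparable (code_string s) t) <->
    (forall t, T t -> comparable_str s t).
  split=> h t.
    by move=> Tt; apply/vcomparableP; apply: h; exact/mem_code_tree.
  by move=> /vmem_code_tree[t' Tt' ->]; apply/vcomparableP; exact: h.
split=> -[/h h1 h2]; split=> //.
  move=> s /h hs; apply/code_string_sub; apply: h2 => //.
  by apply/mem_Str; exists s.
by move=> _ /mem_Str[s ->] /h hs; apply/code_string_sub; exact: h2.
Qed.

Variables (theta : V) (Mtheta : M theta) (P : below theta -> set tree).
Hypotheses (MP : M (code_family P)) (hP : forall xi, ptforcing (P xi)).

Definition vsplitting (xi phi : V) : Prop :=
  (exists2 n, vmem n omega & forall s, vmem s Str ->
     ((exists2 T, M T & vmem (opair s T) phi) <-> vmem (vdom s) n)) /\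
  (forall s, vmem s Str -> forall T, M T -> forall T', M T' ->
     vmem (opair s T) phi -> vmem (opair s T') phi -> T = T') /\
  (forall z, vmem z phi -> exists2 s, vmem s Str & exists2 Q, M Q &
     vmem (opair xi Q) (code_family P) /\ exists2 T, vmem T Q & z = opair s T) /\
  (forall s, vmem s Str -> forall i, vmem i (vnat 2) ->
     forall T, M T -> forall T', M T' ->
     vmem (opair s T) phi -> vmem (opair (vrcons s i) T') phi ->
     vsub T' T /\
     exists2 u, vmem u Str & exists2 v, vmem v Str &
       vstem T u /\ vstem T' v /\ vsub (vrcons u i) v).

Lemma definable_vsplitting i j : definable M (fun e => vsplitting (e i) (e j)).
Proof. rewrite /vsplitting /vstem /vcomparable /vsub; definability. Qed.

Lemma mem_code_family (xi : below theta) y :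
  vmem (opair (proj1_sig xi) y) (code_family P) <-> y = code_set code_tree (P xi).
Proof.
apply: mem_code_fun; first exact: small_elts.
by move=> [x ?] [y' ?] /= e; exact: eq_exist.
Qed.

Lemma model_code_tree xi T : P xi T -> M (code_tree T).
Proof.
move=> PT; have h : vmem (opair (proj1_sig xi) (code_set code_tree (P xi))) (code_family P).
  exact/mem_code_family.
have [_ MQ] := model_opair_inv hM (model_trans hM MP h).
by apply: (model_trans hM MQ); apply/mem_code_set_tree.
Qed.

(** Restricting the quantifiers over trees to [M] loses nothing: trees of [P xi] have their codes in
    [M], and so do the entries of the pairs in [phi]. *)
Lemma vsplittingP (xi : below theta) phi : M phi ->
  vsplitting (proj1_sig xi) phi <->
  exists2 f, splitting_system (P xi) f & phi = code_system f.
Proof.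
move=> Mphi; split.
  move=> [[n0 /mem_omega[n ->] h1] [h2 [h3 h4]]].
  pose f s := if pselect (exists T, vmem (opair (code_string s) (code_tree T)) phi)
    is left h then Some (projT1 (cid h)) else None.
  have h3' z : vmem z phi -> exists s T, P xi T /\ z = opair (code_string s) (code_tree T).
    move=> /h3[s0 /mem_Str[s ->] [Q _ [/mem_code_family -> [T0]]]].
    by move=> /vmem_code_set_tree[T PT ->] ->; exists s, T.
  have fE s T : f s = Some T <-> vmem (opair (code_string s) (code_tree T)) phi.
    have key T1 T2 : vmem (opair (code_string s) (code_tree T1)) phi ->
       vmem (opair (code_string s) (code_tree T2)) phi -> T1 = T2.
      move=> H1 H2; apply: code_tree_inj; apply: (h2 (code_string s)) => //.
      - by apply/mem_Str; exists s.
      - by have [] := model_opair_inv hM (model_trans hM Mphi H1).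
      - by have [] := model_opair_inv hM (model_trans hM Mphi H2).
    rewrite /f; case: pselect => [h|h]; last by split=> // hT; case: h; exists T.
    case: (cid h) => T' T'h /=; split=> [[<-]//|Th].
    by rewrite (key _ _ T'h Th).
  have fP s T : f s = Some T -> P xi T.
    move=> /fE/h3'[s' [T' [PT' /opair_inj[_ /code_tree_inj ->]]]] //.
  exists f; last first.
    apply: vmem_ext => z; rewrite vmem_code_system; split.
      move=> zp; have [s [T [PT zE]]] := h3' z zp; exists s, T; split=> //.
      by apply/fE; rewrite -zE.
    by move=> [s [T [/fE h ->]]].
  split=> //.
    exists n => s; have sS : vmem (code_string s) Str by apply/mem_Str; exists s.
    have := h1 _ sS; rewrite vdom_code_string vmem_vnat => h.
    apply/idP/idP => [|sn].
      case fs : (f s) => [T|//] _; have /fE h' := fs.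
      have [|m mn /vnat_inj -> //] := iffLR h.
      by exists (code_tree T) => //; apply: model_code_tree; exact: fP fs.
    have [|T0 _ hT0] := iffRL h; first by exists (size s).
    have [s' [T [PT /opair_inj[ss TT]]]] := h3' _ hT0.
    by have /fE -> : vmem (opair (code_string s) (code_tree T)) phi by rewrite -TT.
  move=> s i T T' fT fT'.
  have PT := fP _ _ fT; have PT' := fP _ _ fT'.
  have [||||||+ [u0 /mem_Str[u ->] [v0 /mem_Str[v ->] [/vstemP hu [/vstemP hv huv]]]]] :=
    h4 (code_string s) _ (vnat i) _ (code_tree T) _ (code_tree T') _ _ _.
  - by apply/mem_Str; exists s.
  - by apply/vmem_vnat; exists i => //; case: (i).
  - exact: model_code_tree PT.
  - exact: model_code_tree PT'.
  - exact/fE.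
  - by rewrite code_string_rcons; exact/fE.
  move=> /code_tree_sub TT'; split=> //.
  rewrite (stemE hu) (stemE hv); apply/code_string_sub.
  by rewrite -code_string_rcons.
move=> [f [[n fn] fP fS] ->]; split; [|split; [|split]].
- exists (vnat n); first by apply/mem_omega; exists n.
  move=> _ /mem_Str[s ->]; rewrite vdom_code_string; split.
    move=> [T0 _ /mem_code_system[T fsT _]]; apply/vmem_vnat; exists (size s) => //.
    by rewrite -fn fsT.
  move=> /vmem_vnat[m mn /vnat_inj sm]; rewrite -sm -fn in mn.
  case fs : (f s) mn => [T|//] _; exists (code_tree T).
    exact: model_code_tree (fP _ _ fs).
  by apply/mem_code_system; exists T.
- move=> _ /mem_Str[s ->] T0 _ T1 _ /mem_code_system[T fsT ->] /mem_code_system[T' fsT' ->].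
  by move: fsT'; rewrite fsT => -[->].
- move=> z /vmem_code_system[s [T [fsT ->]]].
  exists (code_string s); first by apply/mem_Str; exists s.
  exists (code_set code_tree (P xi)).
    have h : vmem (opair (proj1_sig xi) (code_set code_tree (P xi))) (code_family P).
      exact/mem_code_family.
    by have [] := model_opair_inv hM (model_trans hM MP h).
  split; first exact/mem_code_family.
  by exists (code_tree T) => //; apply/mem_code_set_tree; exact: fP fsT.
- move=> _ /mem_Str[s ->] i0 /vmem_vnat[i i2 ->] T0 _ T1 _ /mem_code_system[T fsT ->].
  have -> : vnat i = vnat (i == 1) by case: i i2 => [|[|]].
  rewrite code_string_rcons => /mem_code_system[T' fsT' ->].
  have [TT' st] := fS _ _ _ _ fsT fsT'.
  split; first by apply/code_tree_sub.
  have perf U t : f t = Some U -> is_stem U (stem U).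
    by move=> /fP PU; apply: perfect_tree_stem; exact: (proj1 (hP xi)).
  exists (code_string (stem T)); first by apply/mem_Str; eexists.
  exists (code_string (stem T')); first by apply/mem_Str; eexists.
  rewrite code_string_rcons; split; first by apply/vstemP; exact: perf fsT.
  split; first by apply/vstemP; exact: perf fsT'.
  exact/code_string_sub.
Qed.

End Multisystems.

(** * Finitely supported functions and the set of all multisystems *)

Section MultisystemSet.
Variables (M : set V) (hM : countable_transitive_model M).

Definition vadd (x y : V) : V := vcup x (setof [set y]).

Lemma generated_finite X (A : set V) : finite_set A -> A `<=` elts X ->
  exists2 z, generated vadd X (vnat 0) z & elts z = A.
Proof.
move: A; apply: finite_set_ind => [_|A x _ IH xA].
  by exists (vnat 0); [left|exact: elts0].
have [|z gz zE] := IH; first by move=> y Ay; apply: xA; right.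
exists (vadd z x); first by right => //; apply: xA; left.
by rewrite elts_vcup elts1 zE setUC.
Qed.

(* The graph [z] with the pair [x] replacing the pair of the same argument. *)
Definition vupdate (z x : V) : V :=
  vcup (setof [set w | vmem w z /\ ~ (exists2 p, M p & exists2 a, M a &
    exists2 b, M b & w = opair p a /\ x = opair p b)]) (setof [set x]).

Definition fupdate (I : Type) (f : I -> V) (p : I) (y : V) (q : I) : V :=
  if pselect (q = p) then y else f q.

Lemma vupdate_code (I : Type) (cI : I -> V) (f : I -> V) p y :
  small I -> injective cI ->
  M (code_fun cI id f) -> M (opair (cI p) y) ->
  vupdate (code_fun cI id f) (opair (cI p) y) = code_fun cI id (fupdate f p y).
Proof.
move=> sI icI Mf Mpy; have [Mp My] := model_opair_inv hM Mpy.
apply: vmem_ext => z; rewrite vmem_vcup vmem1 vmem_code_fun //.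
rewrite vmem_setof; last first.
  by apply: (@is_set_sub _ (code_fun cI id f)) => w [].
rewrite /= /fupdate; split=> [[[zf zn]|->]|[q ->]].
- have [q zE] := (iffLR (vmem_code_fun cI id f z sI)) zf.
  exists q; case: pselect => // qp; case: zn.
  have Mz := model_trans hM Mf zf; rewrite zE in Mz.
  have [Mq Mfq] := model_opair_inv hM Mz.
  by exists (cI q) => //; exists (f q) => //; exists y => //; split=> //; rewrite qp.
- by exists p; case: pselect.
case: pselect => [qp|qp] /=; [by right; rewrite qp|left].
split; first by apply/vmem_code_fun => //; exists q.
by move=> [u _ [a _ [b _ [/opair_inj[<- _] /opair_inj[/icI pq _]]]]]; case: qp.
Qed.

Lemma definable_vupdate i j :
  definable_fun M (fun e => vupdate (e i) (e j)).
Proof. rewrite /vupdate; definability. Qed.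

Lemma finite_support_fupdate (I : Type) (f : I -> V) p y :
  finite_set [set q | f q <> vnat 0] ->
  finite_set [set q | fupdate f p y q <> vnat 0].
Proof.
move=> ff; apply: (@sub_finite_set _ _ (p |` [set q | f q <> vnat 0])).
  by move=> q; rewrite /= /fupdate; case: pselect => [qp|_] /=; [left|right].
by rewrite finite_setU; split=> //; exact: finite_set1.
Qed.

(** Every such function arises from the constant zero function by finitely many one-point updates.
    Zero is the empty set, which is also the code of the empty system. *)
Lemma model_finite_support_funs (I : Type) (cI : I -> V) (S iS : V) :
  small I -> injective cI -> M S -> vmem (vnat 0) S -> M iS -> elts iS = range cI ->
  exists2 b, M b &
    elts b = [set z | exists f : I -> V, [/\ z = code_fun cI id f,
      forall p, vmem (f p) S & finite_set [set p | f p <> vnat 0]]].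
Proof.
move=> sI icI MS S0 MI IE.
have M0 := model_vnat hM 0.
have mI p : vmem (cI p) iS by rewrite -[vmem _ _]/(elts _ _) IE; exists p.
have [X MX XE] := model_prod hM MI MS.
have mX p y : vmem y S -> vmem (opair (cI p) y) X.
  move=> yS; rewrite -[vmem _ _]/(elts _ _) XE; exists (cI p) => //.
  by exists y.
have [|x0 Mx0 x0E] := model_image hM (t := fun _ => iS) (f := fun p _ => opair p (vnat 0))
  (e := fun _ => iS) (definable_fun_const MI) (fun _ => MI).
  definability.
have x0E' : x0 = code_fun cI id (fun _ => vnat 0).
  apply: V_ext; rewrite x0E IE; apply/predeqP => z.
  rewrite -[elts _ _]/(vmem _ _) vmem_code_fun //; split=> [[_ [p _ <-] <-]|[p ->]].
    by exists p.
  by exists (cI p) => //; exists p.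
have [|b Mb bE] := model_generated hM (F := vupdate) MX Mx0.
  exact: definable_vupdate.
exists b => //; rewrite bE; apply/predeqP => z; split=> [gz|[f [-> fS ff]]].
  have : M z by apply: (model_trans hM Mb); rewrite -[vmem _ _]/(elts _ _) bE.
  elim: gz => [_|a x ga IH xX _].
    exists (fun _ => vnat 0); split=> //.
    by apply: (sub_finite_set _ (finite_set0 _)) => p /=; case.
  have Ma : M a by apply: (model_trans hM Mb); rewrite -[vmem _ _]/(elts _ _) bE.
  have [f [aE fS ff]] := IH Ma.
  have Mx := model_trans hM MX xX.
  move: xX; rewrite -[vmem x X]/(elts X x) XE => -[u uI [y yS xE]].
  move: uI; rewrite -[vmem u iS]/(elts iS u) IE => -[p _ pu].
  exists (fupdate f p y); split.
  - rewrite aE xE -pu; apply: vupdate_code => //; first by rewrite -aE.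
    by rewrite pu -xE.
  - by move=> q; rewrite /fupdate; case: pselect => qp /=.
  - exact: finite_support_fupdate.
have gM y : generated vupdate X x0 y -> M y.
  by move=> gy; apply: (model_trans hM Mb); rewrite -[vmem _ _]/(elts _ _) bE.
(* The support is replaced by a finite superset, so that the induction may drop a point even where
   [f] vanishes. *)
have {ff} [A fA Af] : exists2 A, finite_set A & forall p, ~ A p -> f p = vnat 0.
  by exists [set p | f p <> vnat 0] => // p; exact: contrapT.
move: A fA f fS Af; apply: finite_set_ind => [f _ f0|A p _ IH f fS fA].
  by have -> : f = (fun _ => vnat 0); [apply/funext => p; exact: f0|rewrite -x0E'; left].
have gf : generated vupdate X x0 (code_fun cI id (fupdate f p (vnat 0))).
  apply: IH => q; rewrite /fupdate; case: pselect => //= qp Aq.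
  by apply: fA => -[].
have -> : code_fun cI id f = vupdate (code_fun cI id (fupdate f p (vnat 0))) (opair (cI p) (f p)).
  rewrite vupdate_code //.
  - congr (code_fun _ _ _); apply/funext => q; rewrite /fupdate.
    by case: pselect => [qp|qp] //=; rewrite qp.
  - exact: gM.
  - exact: (model_trans hM MX (mX _ _ (fS p))).
by right=> //; exact: mX.
Qed.

Variables (theta : V) (Mtheta : M theta) (P : below theta -> set tree).
Hypotheses (MP : M (code_family P)) (hP : forall xi, ptforcing (P xi)).

(** A system is a finite set of pairs, and the finite subsets of a set of [M] are obtained by
    adjoining one element at a time. *)
Lemma model_system_bound : exists2 S, M S & vmem (vnat 0) S /\
  forall xi f, splitting_system (P xi) f -> vmem (code_system f) S.
Proof.
have [Str MStr StrE] := model_strings hM.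
(* The first union yields the members of the pairs in the family, the second the entries of these
   pairs, the third the elements of the entries. The codes of all trees of all [P xi] are among the
   last. *)
have [U1 MU1 U1E] := model_union hM MP.
have [U2 MU2 U2E] := model_union hM MU1.
have [U3 MU3 U3E] := model_union hM MU2.
have PU xi T : P xi T -> vmem (code_tree T) U3.
  move=> PT; rewrite -[vmem _ _]/(elts _ _) U3E.
  exists (code_set code_tree (P xi)); first exact/mem_code_set_tree.
  rewrite -[vmem _ _]/(elts _ _) U2E.
  exists (setof [set proj1_sig xi; code_set code_tree (P xi)]).
    by rewrite vmem_setof; [right|exact: is_set2].
  rewrite -[vmem _ _]/(elts _ _) U1E.
  exists (opair (proj1_sig xi) (code_set code_tree (P xi))).
    by rewrite vmem_setof; [right|exact: is_set2].
  exact/mem_code_family.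
have [X MX XE] := model_prod hM MStr MU3.
have [|S MS SE] := model_generated hM (F := vadd) MX (model_vnat hM 0).
  by rewrite /vadd; definability.
exists S => //; split; first by rewrite -[vmem _ _]/(elts _ _) SE; left.
move=> xi f [[n fn] fP _]; rewrite -[vmem _ _]/(elts _ _) SE.
have [|z zX|z gz zE] := @generated_finite X (elts (code_system f)).
- apply: (@sub_finite_set _ _ ((fun s => opair (code_string s) (code_tree (odflt setT (f s))))
    @` [set s | size s < n])); last exact/finite_image/finite_strings.
  move=> z /vmem_code_system[s [T [fsT ->]]]; exists s => /=; last by rewrite fsT.
  by rewrite -fn fsT.
- have /vmem_code_system[s [T [fsT ->]]] : vmem z (code_system f) by [].
  rewrite XE; exists (code_string s).
    by rewrite -[vmem _ _]/(elts _ _) StrE; exists s.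
  by exists (code_tree T) => //; exact: PU (fP _ _ fsT).
by rewrite -(elts_inj zE).
Qed.

Lemma model_multisystems : exists2 b, M b &
  elts b = @code_multisystem theta @` MS P.
Proof.
have [Str MStr StrE] := model_strings hM.
have [w Mw wE] := model_omega hM.
have [iS MI IE] := model_index hM Mtheta.
have [S MS [S0 SE]] := model_system_bound.
have sI := small_index theta; have icI := @code_index_inj theta.
have [B MB BE] := model_finite_support_funs sI icI MS S0 MI IE.
have [|b Mb bE] := model_separation hM (R := fun z _ =>
   forall xi, vmem xi theta -> forall k, vmem k w -> forall phi, M phi ->
     vmem (opair (opair xi k) phi) z -> vsplitting M Str w P xi phi)
   (e := fun _ => w) (a := B) (fun _ => Mw) MB.
  have dv := definable_vsplitting hM MStr Mw MP.
  definability; exact: dv.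
exists b => //; rewrite bE; apply/predeqP => z; split=> [[zB h]|[Phi [PhiS Phif] <-]].
  have Mz := model_trans hM MB zB.
  move: zB; rewrite -[vmem z B]/(elts B z) BE => -[f [zE fS ff]].
  have Mf p : M (f p) by exact: (model_trans hM MS (fS p)).
  have /choice[Phi PhiP] : forall p : Defs.index theta, exists g,
      splitting_system (P p.1) g /\ f p = code_system g.
    move=> p.
    have [|g gs gE] := iffLR (vsplittingP hM StrE wE MP hP p.1 (Mf p)); last by exists g.
    apply: (h _ (proj2_sig p.1) (vnat p.2)) => //.
      by rewrite -[vmem _ w]/(elts w _) wE; exists p.2.
    by rewrite zE; apply/(mem_code_fun id f p) => //.
  exists Phi.
    split=> [p|]; first by have [] := PhiP p.
    apply: sub_finite_set ff => p [s ps]; rewrite mksetE => fp0.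
    have [_ fE] := PhiP p; case Es : (Phi p s) ps => [T|//] _.
    apply: (@vnat0 (opair (code_string s) (code_tree T))).
    by rewrite -fp0 fE; apply/mem_code_system; exists T.
  rewrite zE; apply: vmem_ext => y; rewrite !vmem_code_fun //.
  split=> -[p ->]; exists p; by have [_ ->] := PhiP p.
have MS' p : vmem (code_system (Phi p)) S by exact: SE (PhiS p).
split.
  rewrite -[vmem _ _]/(elts _ _) BE; exists (fun p => code_system (Phi p)); split=> //.
  apply: sub_finite_set Phif => p; rewrite !mksetE => hp; apply: contrapT => hs; apply: hp.
  apply: vmem_ext => y; split=> [/vmem_code_system[s [T [psT _]]]|/vnat0//].
  by case: hs; exists s; rewrite psT.
move=> xi xit k; rewrite -[vmem k w]/(elts w k) wE => -[n _ <-] phi Mphi.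
move=> /(@mem_code_multisystem _ Phi (exist _ xi xit, n)) phiE.
apply: (iffRL (vsplittingP hM StrE wE MP hP (exist _ xi xit) Mphi)).
by exists (Phi (exist _ xi xit, n)) => //; exact: (PhiS (exist _ xi xit, n)).
Qed.

Lemma model_definable_multisystems (R : V -> Prop) :
  definable M (fun e => R (e 0)) ->
  M (code_set (@code_multisystem theta)
      [set Phi | MS P Phi /\ R (code_multisystem Phi)]).
Proof.
move=> dR; have [b Mb bE] := model_multisystems.
have [|d Md dE] := model_separation hM (R := fun z _ => R z) (e := fun _ => b) (fun _ => Mb) Mb.
  by [].
rewrite /code_set; suff <- : elts d = @code_multisystem theta @`
  [set Phi | MS P Phi /\ R (code_multisystem Phi)] by rewrite setof_elts.
rewrite dE; apply/predeqP => z; split=> [[]|[Phi [PhiS PhiR] <-]].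
  by rewrite -[vmem z b]/(elts b z) bE => -[Phi PhiS <-] Rz; exists Phi.
by split=> //; rewrite -[vmem _ b]/(elts b _) bE; exists Phi.
Qed.

End MultisystemSet.

(** * Multitrees and direct forcing *)

Lemma comparable_nth s t n : comparable_str s t -> n < size s -> n < size t ->
  nth false s n = nth false t n.
Proof.
by case=> /prefixP[u ->] h1 h2; rewrite nth_cat ?h1 ?h2.
Qed.

Lemma comparable_size_eq s t : comparable_str s t -> size s = size t -> s = t.
Proof.
by case; rewrite prefixE => /eqP + e; [rewrite e|rewrite -e]; rewrite take_size.
Qed.

Lemma nth_prefix (s t : seq bool) : size s <= size t ->
  (forall n, n < size s -> nth false s n = nth false t n) -> prefix s t.
Proof.
move=> st h; rewrite prefixE; apply/eqP; apply: (@eq_from_nth _ false).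
  exact: size_takel.
by move=> i; rewrite size_takel // => is'; rewrite nth_take // h.
Qed.

Lemma perfect_setT : perfect_tree setT.
Proof.
split=> //; first by exists [::].
by move=> s _; exists s; split=> //; exact: prefix_refl.
Qed.

Lemma perfect_tree_nil T : perfect_tree T -> T [::].
Proof. by move=> [treeT [s Ts] _]; exact: treeT (prefix0s _) Ts. Qed.

(** Perfectness gives every node a successor in the tree; iterating a choice of successors from [u]
    traces the branch. *)
Lemma perfect_tree_branch T u : perfect_tree T -> T u ->
  exists2 x, body T x & mkseq x (size u) = u.
Proof.
move=> [treeT _ splT] Tu.
have /choice[nxt nxtP] : forall s, exists i : bool, T s -> T (rcons s i).
  move=> s; have [/splT[t [st t0 _]]|nTs] := pselect (T s); last by exists true.
  have /prefixP[v tE] := st; case: v tE => [|i v] tE.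
    by exists false => _; rewrite cats0 in tE; rewrite -tE.
  exists i => _; apply: treeT t0; apply: prefix_trans (prefix_rcons t false).
  by rewrite tE -cat_rcons prefix_prefix.
pose st n := iter n (fun s => rcons s (nxt s)) u.
have Tst n : T (st n) by elim: n => //= n; exact: nxtP.
have sst n : size (st n) = size u + n.
  by elim: n => [|n IH]; rewrite ?addn0 //= size_rcons IH addnS.
have pst m n : m <= n -> prefix (st m) (st n).
  elim: n => [|n IH]; first by rewrite leqn0 => /eqP ->; exact: prefix_refl.
  rewrite leq_eqVlt => /orP[/eqP ->|]; first exact: prefix_refl.
  by rewrite ltnS => /IH h; apply: (prefix_trans h); exact: prefix_rcons.
(* [st n.+1] has an entry at position [n] even if [u] is empty. *)
pose x n := nth false (st n.+1) n.
have xE m n : n < size (st m) -> x n = nth false (st m) n.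
  move=> nm; apply: comparable_nth; rewrite ?sst ?addnS ?ltnS ?leq_addl //; last by rewrite -sst.
  by case: (leqP n.+1 m) => h; [left|right]; apply: pst => //; exact: ltnW.
exists x.
  move=> n; apply: (treeT _ (st n)) => //; apply: nth_prefix => [|i].
    by rewrite size_mkseq sst leq_addl.
  rewrite size_mkseq => ni; rewrite nth_mkseq // (xE n) // sst.
  exact: (leq_trans ni (leq_addl _ _)).
apply: (@eq_from_nth _ false); first by rewrite size_mkseq.
by move=> i; rewrite size_mkseq => iu; rewrite nth_mkseq // (xE 0) // sst addn0.
Qed.

Section Forcing.
Variables (theta : V) (P : below theta -> set tree).
Hypothesis hP : forall xi, ptforcing (P xi).

Lemma MT_perfect tau p : MT P tau -> perfect_tree (tau p).
Proof.
by move=> [/(_ p)[/(proj1 (hP p.1)) //|-> _]]; exact: perfect_setT.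
Qed.

Lemma mt_le_trans (rho sigma tau : multitree theta) :
  mt_le rho sigma -> mt_le sigma tau -> mt_le rho tau.
Proof. by move=> h1 h2 p; exact: subset_trans (h1 p) (h2 p). Qed.

Lemma support_le (sigma tau : multitree theta) :
  mt_le sigma tau -> Defs.support tau `<=` Defs.support sigma.
Proof.
move=> st p; apply: contra_not => sp; apply/seteqP; split=> // x _.
by apply: st; rewrite sp.
Qed.

Lemma mt_body_le (sigma tau : multitree theta) :
  mt_le sigma tau -> mt_body sigma `<=` mt_body tau.
Proof.
by move=> st x xs p pt n; apply: (st); apply: xs; exact: (support_le st pt).
Qed.

Lemma MT_branch tau p u : MT P tau -> tau p u ->
  exists2 x, mt_body tau x & mkseq (x p) (size u) = u.
Proof.
move=> tauP pu.
have /choice[x xP] : forall q, exists x, body (tau q) x /\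
    (q = p -> mkseq x (size u) = u).
  move=> q; have [->|qp] := pselect (q = p).
    by have [x xb xu] := perfect_tree_branch (MT_perfect p tauP) pu; exists x.
  have [x xb _] := perfect_tree_branch (MT_perfect q tauP)
    (perfect_tree_nil (MT_perfect q tauP)).
  by exists x.
by exists x; [move=> q _; case: (xP q)|case: (xP p) => _; exact].
Qed.

Lemma MT_body_nonempty tau : MT P tau -> mt_body tau !=set0.
Proof.
move=> tauP.
have /choice[x xP] : forall q, exists x, body (tau q) x.
  move=> q; have [x xb _] := perfect_tree_branch (MT_perfect q tauP)
    (perfect_tree_nil (MT_perfect q tauP)).
  by exists x.
by exists x => q _; exact: xP.
Qed.

Lemma forces_value_le (sigma tau : multitree theta) (c : rname theta) n i :
  mt_le sigma tau -> forces_value tau c n i -> forces_value sigma c n i.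
Proof.
move=> /mt_body_le st [S [fS Sc tS]]; exists S; split=> //.
exact: subset_trans st tS.
Qed.

Lemma forces_neq_le (sigma tau : multitree theta) (c d : rname theta) :
  mt_le sigma tau -> forces_neq tau c d -> forces_neq sigma c d.
Proof.
move=> st [s [t [nst hs ht]]]; exists s, t; split=> // n nn.
  by apply: forces_value_le st _; exact: hs.
by apply: forces_value_le st _; exact: ht.
Qed.

Definition mt_update (tau : multitree theta) p T : multitree theta :=
  fun q => if pselect (q = p) then T else tau q.

Lemma MT_update tau p T : MT P tau -> P p.1 T -> MT P (mt_update tau p T).
Proof.
move=> [tauP taus] PT; split.
  move=> q; rewrite /mt_update; case: pselect => [qp|_] /=; last exact: tauP.
  by left; rewrite qp.
apply: (@sub_finite_set _ _ (p |` Defs.support tau)).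
  by move=> q; rewrite /Defs.support /= /mt_update; case: pselect => [qp|_] /=; [left|right].
by rewrite finite_setU; split=> //; exact: finite_set1.
Qed.

(** Induction on the cover: if a modification of [tau] lies below [sigma], compatibility is
    immediate. Otherwise it can be shrunk out of the body of [sigma], and the rest of the cover
    suffices. *)
Lemma MT_cover (S : set (multitree theta)) : finite_set S -> S `<=` MT P ->
  forall tau, MT P tau -> mt_body tau `<=` \bigcup_(sigma in S) mt_body sigma ->
  exists2 sigma, S sigma & compatible P sigma tau.
Proof.
move: S; apply: finite_set_ind => [_ tau tauP h|S sigma _ IH SP tau tauP h].
  by have [x /h[]] := MT_body_nonempty tauP.
have sigmaP : MT P sigma by apply: SP; left.
(* Filling the full components of [tau] with those of [sigma] ensures that a component not contained
   in that of [sigma] is a tree of the forcing, and so may be restricted to a node. *)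
pose tau' p := if pselect (tau p = setT) then sigma p else tau p.
have tauP' : MT P tau'.
  split=> [p|]; first by rewrite /tau'; case: pselect => _ /=; [case: sigmaP|case: tauP].
  apply: (@sub_finite_set _ _ (Defs.support sigma `|` Defs.support tau)).
    by move=> p; rewrite /Defs.support /= /tau'; case: pselect => _ /=; [left|right].
  by rewrite finite_setU; split; [case: sigmaP|case: tauP].
have tau'_le : mt_le tau' tau.
  move=> p; rewrite /tau'; case: pselect => [e|e] /=; last by [].
  by move=> x _; rewrite e.
have [tau's|] := pselect (mt_le tau' sigma).
  by exists sigma; [left|exists tau'].
move=> /existsNP[p] /existsNP[u] /not_implyP[tau'u sigmau].
have Ptau' : P p.1 (tau' p).
  have spN : sigma p <> setT by move=> e; apply: sigmau; rewrite e.
  rewrite /tau'; case: pselect => [_|tp] /=.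
    by case: sigmaP => /(_ p)[].
  by case: tauP => /(_ p)[].
(* Every branch through [u] leaves [sigma p], so the restricted multitree has a body disjoint from
   that of [sigma]. *)
pose tau'' := mt_update tau' p (restrict_tree (tau' p) u).
have tau''P : MT P tau'' by apply: MT_update => //; apply: (proj2 (hP p.1)).
have tau''_le : mt_le tau'' tau'.
  move=> q; rewrite /tau'' /mt_update; case: pselect => [qp|qp] x //= [+ _].
  by rewrite qp.
have [| |rho Srho [r [rP rrho rtau]]] := IH _ _ tau''P.
- by move=> x Sx; apply: SP; right.
- move=> x xtau''.
  have /h[rho [rs|Srho] xrho] : mt_body tau x.
  + by apply: (mt_body_le tau'_le); exact: (mt_body_le tau''_le).
  + exfalso; apply: (sigmau); rewrite rs in xrho.
    have spN : Defs.support sigma p by move=> e; apply: sigmau; rewrite e.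
    have tpN : Defs.support tau'' p.
      rewrite /Defs.support /= => e.
      have : tau' p = setT.
        apply/seteqP; split=> // y _; apply: tau''_le; by rewrite e.
      rewrite /tau'; case: pselect => //= e1 e2; exact: spN.
    have := xtau'' p tpN (size u); rewrite /tau'' /mt_update.
    case: pselect => //= _ [_ cu].
    suff <- : mkseq (x p) (size u) = u by exact: xrho.
    by apply/esym; apply: comparable_size_eq cu _; rewrite size_mkseq.
  + by exists rho.
- exists rho; first by right.
  exists r; split=> //; apply: mt_le_trans rtau _.
  exact: mt_le_trans tau''_le tau'_le.
Qed.

(** * Deciding initial segments of the name *)

Variables (c : rname theta).
Hypothesis hc : real_name P c.

(** Stronger than [forces_initial]: one element of the name above [tau] takes the place of a finite
    cover. Unlike bodies, this is expressible in the model. *)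
Definition decides (tau : multitree theta) (s : seq bool) : Prop :=
  forall n, n < size s -> exists2 sigma, c (n, nth false s n) sigma & mt_le tau sigma.

Lemma decides_le sigma tau s : mt_le sigma tau -> decides tau s -> decides sigma s.
Proof.
move=> st ts n /ts[rho crho tr]; exists rho => //; exact: mt_le_trans st tr.
Qed.

Lemma decides_exists tau l : MT P tau ->
  exists sigma s, [/\ MT P sigma, mt_le sigma tau, size s = l & decides sigma s].
Proof.
move=> tauP; elim: l => [|l [sigma [s [sP st sl sd]]]].
  by exists tau, [::]; split=> // p.
have [_ + _] := hc => /(_ l sigma sP)[rho crho [r [rP rrho rs]]].
have [i ci] : exists i, c (l, i) rho by case: crho; [exists false|exists true].
exists r, (rcons s i); split=> //.
- exact: mt_le_trans rs st.
- by rewrite size_rcons sl.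
move=> n; rewrite size_rcons sl ltnS leq_eqVlt nth_rcons sl => /orP[/eqP ->|nl].
  by rewrite ltnn eqxx; exists rho.
by rewrite nl; apply: (decides_le rs sd); rewrite sl.
Qed.

(** The finite cover contains an element compatible with [tau], hence with [sigma]; elements for
    opposite values of the name are incompatible. *)
Lemma decides_agree tau n i j sigma : MT P tau -> c (n, i) sigma ->
  mt_le tau sigma -> forces_value tau c n j -> i = j.
Proof.
move=> tauP csigma ts [S [fS Sc tS]].
have [cP _ cinc] := hc.
have [|rho Srho [r [rP rrho rtau]]] := MT_cover fS _ tauP tS.
  by move=> x /Sc/cP.
have rsigma := mt_le_trans rtau ts; have crho := Sc _ Srho.
case: i j csigma crho {Sc} => -[] // csigma crho; exfalso.
  by apply: (cinc _ _ _ crho csigma); exists r.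
by apply: (cinc _ _ _ csigma crho); exists r.
Qed.

Lemma forces_pi (tau : multitree theta) q n i x : forces_value tau (pi_name q) n i ->
  mt_body tau x -> x q n = i.
Proof.
move=> [S [_ Sp tS]] /tS[rh Srh]; have -> : rh = rho q n i by exact: Sp.
move=> /(_ q) h.
have : Defs.support (rho q n i) q.
  rewrite /Defs.support /= => e.
  (* A string with the wrong entry at position [n] shows that this component is not the full
     tree. *)
  have : rho q n i q (nseq n.+1 (~~ i)) by rewrite e.
  by move=> /(_ erefl); rewrite size_nseq nth_nseq ltnSn => /(_ isT); case: (i).
move=> /h/(_ n.+1) /= /(_ erefl); rewrite size_mkseq nth_mkseq //; exact.
Qed.

Variable eta : below theta.
Hypothesis hD : forall k : nat, mt_dense P
  [set tau | MT P tau /\ forces_neq tau c (pi_name (eta, k))].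

Lemma forces_neq_finite (K : set nat) : finite_set K -> forall tau, MT P tau ->
  exists sigma, [/\ MT P sigma, mt_le sigma tau &
    forall k, K k -> forces_neq sigma c (pi_name (eta, k))].
Proof.
move: K; apply: finite_set_ind => [tau tauP|K k _ IH tau tauP].
  by exists tau; split=> // p.
have [_ /(_ tau tauP)[sigma [sP sk] st]] := hD k.
have [r [rP rs rK]] := IH _ sP; exists r; split=> //.
  exact: mt_le_trans rs st.
by move=> l [->|]; [exact: forces_neq_le sk|exact: rK].
Qed.

(** The string [s] is chosen longer than all strings forced on [c]. A branch of [sigma] through [s]
    at [(eta, k)] would then extend both the string forced on [pi_name (eta, k)] and the
    incomparable one forced on [c]. *)
Lemma avoid_finite (K : set nat) : finite_set K -> forall tau, MT P tau ->
  exists sigma s, [/\ MT P sigma, mt_le sigma tau, decides sigma s &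
    forall k, K k -> ~ sigma (eta, k) s].
Proof.
move=> fK tau tauP; have [tau1 [tP1 t1 tK]] := forces_neq_finite fK tauP.
have /choice[f fP] : forall k, exists f : seq bool * seq bool, K k ->
    [/\ ~ comparable_str f.1 f.2, forces_initial tau1 (pi_name (eta, k)) f.1 &
      forces_initial tau1 c f.2].
  move=> k; have [/tK[r [t [h1 h2 h3]]]|nK] := pselect (K k); last by exists ([::], [::]).
  by exists (r, t).
have [l fl] := finite_set_bound (fun k => size (f k).2) fK.
have [sigma [s [sP st sl sd]]] := decides_exists l tP1.
exists sigma, s; split=> //; first exact: mt_le_trans st t1.
move=> k Kk sks; have [ncomp fr ft] := fP k Kk.
have [x xs xE] := MT_branch sP sks.
apply: ncomp.
have rx : forall n, n < size (f k).1 -> nth false (f k).1 n = x (eta, k) n.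
  move=> n nr; apply/esym/(forces_pi (fr n nr)); exact: mt_body_le st _ xs.
have tx : forall n, n < size (f k).2 -> nth false (f k).2 n = x (eta, k) n.
  move=> n nt; have ns : n < size s by rewrite sl; exact: ltn_trans nt (fl _ Kk).
  have [rh crh srh] := sd n ns.
  rewrite -(decides_agree sP crh srh (forces_value_le st (ft n nt))).
  by rewrite -{1}xE nth_mkseq.
apply: (@prefix_comparable _ _ (mkseq (x (eta, k)) (size (f k).1 + size (f k).2))).
  apply: nth_prefix => [|n nn]; first by rewrite size_mkseq leq_addr.
  by rewrite nth_mkseq ?rx // ltn_addr.
apply: nth_prefix => [|n nn]; first by rewrite size_mkseq leq_addl.
by rewrite nth_mkseq ?tx // ltn_addl.
Qed.

(** Over an empty [P eta] every multitree is full at [(eta, 0)] and forces no nonempty string on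
    [pi_name (eta, 0)], while incomparable strings are nonempty. Extending systems over [P eta]
    relies on this. *)
Lemma forcing_nonempty : P eta !=set0.
Proof.
have [_ /(_ (fun _ => setT))[|tau [tauP [s [t [nst fs ft]]]] _]] := hD 0.
  split=> [p|]; first by right.
  by apply: (sub_finite_set _ (finite_set0 _)) => p; rewrite /Defs.support /=; case.
have [PT|tT] := pselect (P eta (tau (eta, 0))); first by exists (tau (eta, 0)).
have tE : tau (eta, 0) = setT by case: (tauP) => /(_ (eta, 0))[].
have [i [s' sE]] : exists i s', s = i :: s'.
  by case: s nst fs => [|i s'] nst _; [case: nst; left; exact: prefix0s|exists i, s'].
have [|x xt xE] := @MT_branch tau (eta, 0) [:: ~~ i] tauP; first by rewrite tE.
have f0 := fs 0; rewrite sE in f0.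
have := forces_pi (f0 isT) xt; move: xE => /= [->]; by case: (i).
Qed.

End Forcing.

(** * Extending and shrinking multisystems *)

Definition height (phi : system) (n : nat) : Prop :=
  forall s, isSome (phi s) = (size s < n).

Section Systems.
Variable (Q : set tree).
Hypothesis hQ : ptforcing Q.

Lemma stem_sub T T' : Q T -> Q T' -> T' `<=` T -> prefix (stem T) (stem T').
Proof.
move=> /(proj1 hQ)/perfect_tree_stem[hT _] /(proj1 hQ)/perfect_tree_stem[_ mT'] TT'.
by apply: mT' => t /TT'; exact: hT.
Qed.

Lemma stem_restrict T i : Q T ->
  Q (restrict_tree T (rcons (stem T) i)) /\
  prefix (rcons (stem T) i) (stem (restrict_tree T (rcons (stem T) i))).
Proof.
move=> QT; have QR : Q (restrict_tree T (rcons (stem T) i)).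
  by apply: (proj2 hQ) => //; apply: perfect_tree_stem_split; exact: (proj1 hQ).
split=> //; have [_ mR] := perfect_tree_stem (proj1 hQ _ QR).
by apply: mR => t [].
Qed.

(** A new tree is its parent restricted to the stem followed by the last bit of the node; [T0]
    becomes the root of a system that was empty. *)
Lemma splitting_extend1 phi n : splitting_system Q phi -> height phi n -> Q !=set0 ->
  exists psi, [/\ splitting_system Q psi, height psi n.+1 & system_le phi psi].
Proof.
move=> [_ phiQ phiS] hn [T0 QT0].
pose psi s : option tree := if size s == n then
    Some (if s is [::] then T0 else
      let T := odflt T0 (phi (take n.-1 s)) in
      restrict_tree T (rcons (stem T) (last false s)))
  else phi s.
have hpsi : height psi n.+1.
  move=> s; rewrite /psi ltnS leq_eqVlt; case: eqP => //= _; exact: hn.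
have dQ s : Q (odflt T0 (phi s)).
  by case e : (phi s) => [T|] //=; exact: phiQ e.
have le : system_le phi psi.
  move=> s T e; rewrite /psi; case: eqP => // sn.
  by have := hn s; rewrite e sn ltnn.
exists psi; split=> //; split; first by exists n.+1.
  move=> s T; rewrite /psi; case: eqP => [_ [<-]|_]; last exact: phiQ.
  case: s => [//|x s]; exact: (proj1 (stem_restrict _ (dQ _))).
move=> s i T T' hs; rewrite /psi size_rcons; case: eqP => [sn|sn].
  have {hs} phis : phi s = Some T.
    by move: hs; rewrite /psi -sn; case: eqP => // /eqP; rewrite eqn_leq ltnn andbF.
  case e : (rcons s i) => [|x s'] [<-]; first by case: (s) e.
  have tk : take (size s) (rcons s i) = s by rewrite -cats1 take_size_cat.
  have -> : last x s' = i by rewrite -(last_rcons false s i) e.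
  rewrite -e -sn /= tk phis /=.
  have := stem_restrict i (phiQ _ _ phis) => -[_ h]; split=> //.
  by move=> t [].
move=> hT'; apply: (phiS) (hT').
move: hs; rewrite /psi; case: eqP => // sn' _.
by have := hn (rcons s i); rewrite hT' size_rcons sn' ltnNge leqnSn.
Qed.

Lemma splitting_extend phi m n : splitting_system Q phi -> height phi m ->
  Q !=set0 -> m <= n ->
  exists psi, [/\ splitting_system Q psi, height psi n & system_le phi psi].
Proof.
move=> phiS hm Q0; elim: n => [|n IH].
  by rewrite leqn0 => /eqP <-; exists phi; split.
rewrite leq_eqVlt => /orP[/eqP <-|]; first by exists phi; split.
rewrite ltnS => /IH[psi [psiS hn le]].
have [chi [chiS hn1 le']] := splitting_extend1 psiS hn Q0.
by exists chi; split=> // s T /le; exact: le'.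
Qed.

(** The last level has no successors to respect, and towards the parents the condition persists
    because stems can only grow. *)
Lemma splitting_shrink phi n (g : seq bool -> tree) :
  splitting_system Q phi -> height phi n.+1 ->
  (forall s T, size s = n -> phi s = Some T -> Q (g s) /\ g s `<=` T) ->
  splitting_system Q (fun s => if size s == n then Some (g s) else phi s).
Proof.
move=> [_ phiQ phiS] hn hg; split.
- exists n.+1 => s; case: eqP => [->|_]; [by rewrite ltnSn|exact: hn].
- move=> s T; case: eqP => [sn [<-]|_]; last exact: phiQ.
  have := hn s; rewrite sn ltnSn; case e : (phi s) => [T'|//] _.
  by have [] := hg _ _ sn e.
move=> s i T T'; case: eqP => [sn _|sn hs]; rewrite size_rcons.
  rewrite sn; case: eqP => [/eqP|_ h].
    by rewrite eqn_leq ltnn.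
  by have := hn (rcons s i); rewrite h size_rcons sn ltnn.
case: eqP => [sn' [<-]|_]; last exact: phiS.
have sn1 : size (rcons s i) = n by rewrite size_rcons.
have := hn (rcons s i); rewrite sn1 ltnSn; case e : (phi (rcons s i)) => [W|//] _.
have [Qg gW] := hg _ _ sn1 e; have [WT st] := phiS _ _ _ _ hs e.
split; first exact: subset_trans gW WT.
exact: prefix_trans st (stem_sub (phiQ _ _ e) Qg gW).
Qed.

End Systems.

Lemma finite_numbering (T : Type) (A : set T) : finite_set A ->
  exists g : T -> nat, forall x y, A x -> A y -> g x = g y -> x = y.
Proof.
move: A; apply: finite_set_ind => [|A x fA [g gA]]; first by exists (fun _ => 0).
have [n gn] := finite_set_bound g fA.
exists (fun y => if pselect (y = x) then n else g y) => y z Ay Az.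
case: pselect => yx; case: pselect => zx //=.
- by rewrite yx zx.
- case: Az => // /gn + e; by rewrite -e ltnn.
- case: Ay => // /gn + e; by rewrite e ltnn.
- by case: Ay => // Ay; case: Az => // Az; exact: gA.
Qed.

(** * Assignments and the density of avoidance *)

Section Density.
Variables (theta : V) (P : below theta -> set tree).
Hypothesis hP : forall xi, ptforcing (P xi).

(** A coordinate [p] with value [(m, s)] is meant to carry the tree at node [s] of the system
    [(p.1, m)]. *)
Definition assignment : Type := Defs.index theta -> option (nat * seq bool).

Definition finite_assignment (a : assignment) : Prop :=
  finite_set [set p | a p <> None].

(** Incomparability survives lengthening, so padding to a common level keeps distinct coordinates at
    distinct nodes. *)
Definition incomparable_assignment (a : assignment) : Prop :=
  forall p q m s t, p.1 = q.1 -> a p = Some (m, s) -> a q = Some (m, t) ->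
    comparable_str s t -> p = q.

Definition pad n (s : seq bool) : seq bool := s ++ nseq (n - size s) false.

Lemma size_pad n s : size s <= n -> size (pad n s) = n.
Proof. by move=> sn; rewrite size_cat size_nseq subnKC. Qed.

Lemma pad_prefix n s : prefix s (pad n s).
Proof. exact: prefix_prefix. Qed.

(* Completes [a0] so that every node of level [H] of the system [(eta, m0)] is
   the value of some coordinate [(eta, k)]. *)
Lemma complete_assignment (a0 : assignment) (H k0 : nat) (eta : below theta) m0 :
  finite_assignment a0 -> incomparable_assignment a0 ->
  (forall p m s, a0 p = Some (m, s) -> size s <= H /\ p.2 < k0) ->
  exists a1 : assignment, [/\ finite_assignment a1,
    forall p m t, a1 p = Some (m, t) -> size t = H /\
      (p.1 = eta /\ m = m0 /\ k0 <= p.2 \/ exists s, a0 p = Some (m, s)),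
    forall p q m t, p.1 = q.1 -> a1 p = Some (m, t) -> a1 q = Some (m, t) -> p = q,
    forall t, size t = H -> exists k, a1 (eta, k) = Some (m0, t)
  & forall p m s, a0 p = Some (m, s) -> a1 p = Some (m, pad H s)].
Proof.
move=> fa ia ba.
(* A node taken by a padded node of [a0] already has its coordinate. Any other [t] receives number
   [k0 + pickle t]: beyond all numbers in use, and different for different [t]. *)
pose used t := exists p s, [/\ p.1 = eta, a0 p = Some (m0, s) & pad H s = t].
pose fresh (p : Defs.index theta) t := [/\ p.1 = eta, size t = H, p.2 = k0 + pickle t & ~ used t].
pose a1 p := if a0 p is Some (m, s) then Some (m, pad H s)
  else if pselect (exists t, fresh p t) is left h then Some (m0, projT1 (cid h)) else None.
have a1P p m t : a1 p = Some (m, t) ->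
    (exists2 s, a0 p = Some (m, s) & t = pad H s) \/
    [/\ a0 p = None, m = m0 & fresh p t].
  rewrite /a1; case e : (a0 p) => [[m' s]|].
    by move=> [<- <-]; left; exists s.
  case: pselect => // h [<- <-]; right; split=> //; exact: (projT2 (cid h)).
have a1s p m s : a0 p = Some (m, s) -> a1 p = Some (m, pad H s).
  by rewrite /a1 => ->.
exists a1; split=> //.
- apply: (@sub_finite_set _ _ ([set p | a0 p <> None] `|`
    (fun t => (eta, k0 + pickle t)) @` [set t | size t < H.+1])).
    move=> p /=; case e : (a1 p) => [[m t]|//] _.
    case: (a1P _ _ _ e) => [[s ->]|[_ _ [p1 tH p2 _]]]; [by left|right].
    by exists t; rewrite /= ?tH // -p2 -p1 -surjective_pairing.
  by rewrite finite_setU; split=> //; apply: finite_image; exact: finite_strings.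
- move=> p m t /a1P[[s e ->]|[_ -> [p1 tH p2 _]]].
    by split; [apply: size_pad; case: (ba _ _ _ e)|right; exists s].
  by split=> //; left; rewrite p2 leq_addr.
- move=> p q m t pq /a1P hp /a1P hq.
  case: hp => [[s ep tE]|[ep mE' [p1 tH p2 nu]]]; case: hq => [[s' eq' tE']|[eq' mE [q1 _ q2 nu']]].
  + apply: ia pq ep eq' _; apply: (@prefix_comparable _ _ t).
      by rewrite tE pad_prefix.
    by rewrite tE' pad_prefix.
  + by case: nu'; exists p, s; rewrite pq q1 -mE tE.
  + by case: nu; exists q, s'; rewrite -pq p1 -mE'.
  + by rewrite (surjective_pairing p) (surjective_pairing q) pq p2 q2.
- move=> t tH; have [[p [s [p1 ep sp]]]|nu] := pselect (used t).
    exists p.2; rewrite -p1 -surjective_pairing -sp; exact: a1s.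
  exists (k0 + pickle t); rewrite /a1.
  case e : (a0 _) => [[m s]|].
    by have [_] := ba _ _ _ e; rewrite /= ltnNge leq_addr.
  case: pselect => [h|]; last by case; exists t.
  case: (cid h) => t' [/= _ _ /addnI/(pcan_inj pickleK) -> _] //.
Qed.

End Density.

Section AvoidDense.
Variables (theta : V) (P : below theta -> set tree).
Hypothesis hP : forall xi, ptforcing (P xi).
Variables (c : rname theta) (eta : below theta).
Hypotheses (hc : real_name P c)
  (hD : forall k : nat, mt_dense P
    [set tau | MT P tau /\ forces_neq tau c (pi_name (eta, k))]).

(** The trees assigned by [a] lie below [sigma], said without forming a multitree from them. *)
Definition mt_refined (Phi : multisystem theta) (a : assignment theta)
    (sigma : multitree theta) : Prop :=
  forall p, sigma p = setT \/ exists m t T,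
    [/\ a p = Some (m, t), Phi (p.1, m) t = Some T & T `<=` sigma p].

(** The last clause keeps [s] out of a whole level of the system [(eta, m0)], hence out of its root
    fusion tree. *)
Definition avoids (a0 : assignment theta) (nu : multitree theta) (m0 : nat)
    (Phi : multisystem theta) (s : seq bool) (a : assignment theta) : Prop :=
  [/\ forall n, n < size s -> exists2 sigma, c (n, nth false s n) sigma &
        mt_refined Phi a sigma,
      forall p m u, a0 p = Some (m, u) -> exists2 t, prefix u t & a p = Some (m, t),
      mt_refined Phi a nu
    & exists h, forall t, size t = h -> exists2 T, Phi (eta, m0) t = Some T & ~ T s].

Lemma avoids_dense (a0 : assignment theta) (nu : multitree theta) (m0 : nat) :
  finite_assignment a0 -> incomparable_assignment a0 ->
  (forall p m s, a0 p = Some (m, s) -> P p.1 !=set0 /\ nu p = setT) -> MT P nu ->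
  forall Psi, MS P Psi -> exists Phi s a, [/\ MS P Phi, ms_le Psi Phi,
    finite_assignment a & avoids a0 nu m0 Phi s a].
Proof.
move=> fa0 ia0 a0P nuP Psi [PsiS fPsi].
(* The systems to be extended: those in which [a0] names a node, and the one that has to avoid
   [s]. *)
pose K : set (Defs.index theta) := [set q | (exists p s, p.1 = q.1 /\ a0 p = Some (q.2, s)) \/
  q = (eta, m0)].
have K0 q : K q -> P q.1 !=set0.
  by move=> [[p [s [<- e]]]|-> /=]; [case: (a0P _ _ _ e)|exact: (forcing_nonempty hP hD)].
have fK : finite_set K.
  apply: (@sub_finite_set _ _ ((eta, m0) |` (fun p : Defs.index theta =>
     (p.1, (odflt (0, [::]) (a0 p)).1)) @` [set p | a0 p <> None])).
    move=> q [[p [s [pq e]]]|->]; [right|by left].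
    by exists p; rewrite /= e // pq -surjective_pairing.
  by rewrite finite_setU; split; [exact: finite_set1|exact: finite_image].
have /choice[ht htP] : forall q, exists n, height (Psi q) n.
  by move=> q; have [[n hn] _ _] := PsiS q; exists n.
have [H1 H1P] := finite_set_bound ht fK.
have [H2 H2P] := finite_set_bound (fun p => size (odflt (0, [::]) (a0 p)).2) fa0.
have [k1 k1P] := finite_set_bound (fun p : Defs.index theta => p.2) fa0.
have [k2 k2P] := finite_set_bound (fun p : Defs.index theta => p.2) (proj2 nuP).
(* Level [H] lies beyond everything defined in the systems of [K], so its trees may be shrunk
   freely, and no node of [a0] is longer. The bound [k0] keeps the added coordinates outside the
   support of [nu]. *)
pose H := maxn H1 H2; pose k0 := maxn k1 k2.
have HK q : K q -> ht q <= H.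
  by move=> /H1P h; apply: ltnW; apply: leq_trans h (leq_maxl _ _).
have [|a1 [fa1 a1P a1inj a1t a1s]] := complete_assignment (H := H) (k0 := k0) eta m0 fa0 ia0.
  move=> p m s e; have ep : a0 p <> None by rewrite e.
  split.
    have := H2P p ep; rewrite e /= => h.
    by apply: ltnW; apply: leq_trans h (leq_maxr _ _).
  exact: leq_trans (k1P p ep) (leq_maxl _ _).
have a1K p m t : a1 p = Some (m, t) -> K (p.1, m).
  by move=> /a1P[_ [[-> [-> _]]|[s e]]]; [right|left; exists p, s].
have a1H p m t : a1 p = Some (m, t) -> size t = H by move=> /a1P[].
have a1nu p : a1 p <> None -> nu p = setT.
  case e : (a1 p) => [[m t]|//] _; have [_ [[_ [_ kp]]|[s e']]] := a1P _ _ _ e.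
    apply: contrapT => /k2P; rewrite ltnNge; apply/negP/negPn.
    exact: leq_trans (leq_maxr _ _) kp.
  by have [] := a0P _ _ _ e'.
(* Height [H.+1] makes [H] the last level, the one that [splitting_shrink] can change. *)
have /choice[phi1 phi1P] : forall q, exists phi, K q ->
    [/\ splitting_system (P q.1) phi, height phi H.+1 & system_le (Psi q) phi].
  move=> q; have [Kq|nK] := pselect (K q); last by exists (Psi q).
  have [|phi h] := splitting_extend (hP q.1) (n := H.+1) (PsiS q) (htP q) (K0 q Kq).
    exact: leqW (HK q Kq).
  by exists phi.
pose W q t := odflt setT (phi1 q t).
have WP q t : K q -> size t = H -> phi1 q t = Some (W q t) /\ P q.1 (W q t).
  move=> Kq tH; have [[_ phiQ _] hh _] := phi1P q Kq.
  rewrite /W; have := hh t; rewrite tH ltnSn; case e : (phi1 q t) => [T|//] _ /=.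
  by split=> //; exact: phiQ e.
(* Assigned coordinates receive the tree at their node. This stays below [nu], which is full at
   those coordinates. *)
pose tau0 : multitree theta := fun p => if a1 p is Some (m, t) then W (p.1, m) t else nu p.
have tau0P : MT P tau0.
  split.
    move=> p; rewrite /tau0; case e : (a1 p) => [[m t]|]; last by case: nuP.
    by left; have [] := WP (p.1, m) t (a1K _ _ _ e) (a1H _ _ _ e).
  apply: (@sub_finite_set _ _ ([set p | a1 p <> None] `|` Defs.support nu)).
    by move=> p; rewrite /Defs.support /= /tau0; case: (a1 p) => [[m t]|]; [left|right].
  by rewrite finite_setU; split=> //; case: nuP.
have fKk : finite_set [set k | exists t, a1 (eta, k) = Some (m0, t)].
  apply: (@sub_finite_set _ _ (snd @` [set p | a1 p <> None])); last exact: finite_image.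
  by move=> k [t e]; exists (eta, k) => //=; rewrite e.
have [tau [s [tauP tau_le taus tauk]]] := avoid_finite hP hc hD fKk tau0P.
have tau_nu : mt_le tau nu.
  move=> p x /tau_le; rewrite /tau0; case e : (a1 p) => [[m t]|//] _.
  by rewrite a1nu // e.
(* A component below a tree of [P] can be full only if that tree is full, so it is still a member of
   [P]. *)
have tauPp p : a1 p <> None -> P p.1 (tau p).
  move=> ep; have [/(_ p)[//|tT] _] := tauP.
  case e : (a1 p) ep => [[m t]|//] _.
  have [_ PW] := WP _ _ (a1K _ _ _ e) (a1H _ _ _ e).
  suff -> : tau p = W (p.1, m) t by [].
  apply/seteqP; split; first by have := tau_le p; rewrite /tau0 e.
  by rewrite tT.
have [mu1 mu1P] := finite_set_bound (fun q : Defs.index theta => q.2) fK.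
have [mu2 mu2P] := finite_set_bound (fun q : Defs.index theta => q.2) fPsi.
(* Systems numbered from [mu] on are empty in [Psi] and lie outside [K]; they are free to hold the
   new components of [tau]. *)
pose mu := maxn mu1 mu2.
have muK q : K q -> q.2 < mu by move=> /mu1P h; exact: leq_trans h (leq_maxl _ _).
have muPsi q t : mu <= q.2 -> Psi q t = None.
  move=> mq; case e : (Psi q t) => [T|//].
  have /mu2P h : exists s, isSome (Psi q s) by exists t; rewrite e.
  by have := leq_trans h (leq_trans (leq_maxr mu1 _) mq); rewrite ltnn.
(* The new trees of level [H]. As distinct coordinates sit at distinct nodes, a node has at most one
   coordinate, whose component of [tau] it takes over. *)
pose g (q : Defs.index theta) t :=
  if pselect (exists p : Defs.index theta, p.1 = q.1 /\ a1 p = Some (q.2, t)) is left h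
  then tau (projT1 (cid h)) else W q t.
have gE p m t : a1 p = Some (m, t) -> g (p.1, m) t = tau p.
  move=> e; rewrite /g; case: pselect => [h|]; last by case; exists p.
  case: (cid h) => q [/= pq eq']; congr tau; exact: a1inj pq eq' e.
have gP q t : K q -> size t = H -> P q.1 (g q t) /\ g q t `<=` W q t.
  move=> Kq tH; rewrite /g; case: pselect => [h|nh]; last first.
    by have [_ PW] := WP q t Kq tH; split.
  case: (cid h) => p [pq e] /=; rewrite -pq; split; first by apply: tauPp; rewrite e.
  by have := tau_le p; rewrite /tau0 e pq -surjective_pairing.
(* The fresh system [(xi, mu + k)] is the single root [tau (xi, k)], or is empty if that component
   is full. *)
pose Phi : multisystem theta := fun q =>
  if mu <= q.2 then
    fun t => if (t == [::]) && `[< tau (q.1, q.2 - mu) <> setT >]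
      then Some (tau (q.1, q.2 - mu)) else None
  else if pselect (K q) then fun t => if size t == H then Some (g q t) else phi1 q t
  else Psi q.
have PhiK q t : K q -> size t = H -> Phi q t = Some (g q t).
  move=> Kq tH; rewrite /Phi leqNgt muK //=; case: pselect => //= _.
  by rewrite tH eqxx.
pose a : assignment theta := fun p => if a1 p is Some x then Some x
  else if `[< tau p <> setT >] then Some (mu + p.2, [::]) else None.
have aref sigma : mt_le tau sigma -> mt_refined Phi a sigma.
  move=> ts p; case e : (a1 p) => [[m t]|].
    right; exists m, t, (tau p); rewrite /a e; split=> //.
    by rewrite PhiK; [rewrite gE|exact: a1K e|exact: a1H e].
  have [tT|tN] := pselect (tau p = setT).
    by left; apply/seteqP; split=> // x _; apply: ts; rewrite tT.
  right; exists (mu + p.2), [::], (tau p); rewrite /a e; split=> //.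
    by rewrite asboolT.
  by rewrite /Phi /= leq_addr addKn -surjective_pairing asboolT.
exists Phi, s, a; split.
- split=> [q|].
    rewrite /Phi; case: ifP => mq.
      have [tT|tN] := pselect (tau (q.1, q.2 - mu) = setT).
        have n0 : `[< tau (q.1, q.2 - mu) <> setT >] = false by apply/asboolP; case.
        rewrite n0; split; [exists 0 => t| |] => [|t T|t i T T']; by rewrite andbF.
      have n0 : `[< tau (q.1, q.2 - mu) <> setT >] by apply/asboolP.
      rewrite n0; split.
      + by exists 1 => -[|x t].
      + by move=> [|x t] //= T [<-]; case: tauP => /(_ (q.1, q.2 - mu))[].
      + by move=> t i T T' _; case: t.
    case: pselect => Kq /=; last exact: PsiS.
    have [phiS hh _] := phi1P q Kq.
    apply: splitting_shrink phiS hh _ => //; move=> t T tH e.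
    have [e' _] := WP q t Kq tH; have [Pg gW] := gP q t Kq tH.
    by move: e'; rewrite e => -[->].
  apply: (@sub_finite_set _ _ (K `|` ([set q | exists s, isSome (Psi q s)] `|`
     (fun p : Defs.index theta => (p.1, mu + p.2)) @` Defs.support tau))).
    move=> q [t]; rewrite /Phi; case: ifP => mq.
      case: ifP => // /andP[_ /asboolP h] _; right; right; exists (q.1, q.2 - mu) => //=.
      by rewrite subnKC // -surjective_pairing.
    by case: pselect => /= Kq h; [left|right; left; exists t].
  rewrite finite_setU; split=> //; rewrite finite_setU; split=> //.
  exact: finite_image (proj2 tauP).
- move=> q t T e; rewrite /Phi; case: ifP => mq; first by rewrite muPsi in e.
  case: pselect => //= Kq; case: eqP => tH.
    have := htP q t; rewrite e tH => /esym; rewrite ltnNge HK //.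
  by have [_ _] := phi1P q Kq; exact.
- apply: (@sub_finite_set _ _ ([set p | a1 p <> None] `|` Defs.support tau)).
    move=> p; rewrite /= /a; case: (a1 p) => [x|]; first by left.
    by case: asboolP => // h _; right.
  by rewrite finite_setU; split=> //; case: tauP.
- split.
  + by move=> n /taus[sigma cs ts]; exists sigma => //; exact: aref.
  + move=> p m u /a1s e; exists (pad H u); first exact: pad_prefix.
    by rewrite /a e.
  + exact: aref.
  (* Every node of level [H] of [(eta, m0)] belongs to a coordinate [(eta, k)], and [tau] omits [s]
     there. *)
  + exists H => t tH; have [k e] := a1t t tH.
    exists (tau (eta, k)); last by apply: tauk; exists t.
    by rewrite PhiK //; [rewrite -(gE _ _ _ e)|right].
Qed.

End AvoidDense.

(** * The dense set belongs to the model *)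

Section AvoidInModel.
Variables (M : set V) (hM : countable_transitive_model M).
Variables (theta : V) (Mtheta : M theta) (P : below theta -> set tree).
Hypotheses (MP : M (code_family P)) (hP : forall xi, ptforcing (P xi)).
Variables (c : rname theta) (Mc : M (code_rname c)) (eta : below theta).
Variables (Str omega : V) (MStr : M Str) (StrE : elts Str = range code_string).
Hypotheses (Momega : M omega) (omegaE : elts omega = range vnat).

Definition vval (z q t T : V) : Prop :=
  exists2 phi, M phi & vmem (opair q phi) z /\ vmem (opair t T) phi.

(** The set [Str] of all strings is the code of the full tree. *)
Definition vrefined (z a sigma : V) : Prop :=
  forall xi, vmem xi theta -> forall k, vmem k omega -> forall S, M S ->
  vmem (opair (opair xi k) S) sigma -> S = Str \/
  exists2 m, vmem m omega & exists2 t, vmem t Str & exists2 T, M T &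
    vmem (opair (opair xi k) (opair m t)) a /\
    vval z (opair xi m) t T /\ vsub T S.

(** This is the condition under which an assignment can be read off from an arbitrary set of the
    model. *)
Definition vfunctional (a : V) : Prop :=
  forall xi, vmem xi theta -> forall k, vmem k omega ->
  forall m, vmem m omega -> forall t, vmem t Str ->
  forall m', vmem m' omega -> forall t', vmem t' Str ->
  vmem (opair (opair xi k) (opair m t)) a ->
  vmem (opair (opair xi k) (opair m' t')) a -> m = m' /\ t = t'.

(** The assignment is sought in [M]; the finite ones produced by the density argument are
    represented there. *)
Definition vavoids (A0 A1 m0 z : V) : Prop :=
  exists2 s, vmem s Str & exists2 a, M a &
  vfunctional a /\
  (forall n, vmem n omega -> forall i, vmem i (vnat 2) -> vmem (opair n i) s ->
     exists2 C, M C & vmem (opair (opair n i) C) (code_rname c) /\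
     exists2 sigma, vmem sigma C & vrefined z a sigma) /\
  (forall xi, vmem xi theta -> forall k, vmem k omega ->
   forall m, vmem m omega -> forall u, vmem u Str ->
   vmem (opair (opair xi k) (opair m u)) A0 ->
   exists2 t, vmem t Str & vsub u t /\ vmem (opair (opair xi k) (opair m t)) a) /\
  vrefined z a A1 /\
  exists2 h, vmem h omega & forall t, vmem t Str -> vdom t = h ->
    exists2 T, M T & vval z (opair (proj1_sig eta) m0) t T /\ ~ vmem s T.

Lemma definable_vavoids A0 A1 m0 : M A0 -> M A1 -> M m0 ->
  definable M (fun e => vavoids A0 A1 m0 (e 0)).
Proof.
move=> MA0 MA1 Mm0; have Meta := model_trans hM Mtheta (proj2_sig eta).
rewrite /vavoids /vfunctional /vrefined /vval /vsub; definability.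
Qed.

Definition represents (a : assignment theta) (z : V) : Prop :=
  forall p m t, vmem (opair (code_index p) (opair (vnat m) (code_string t))) z <->
    a p = Some (m, t).

Let in_Str s : vmem (code_string s) Str.
Proof. by apply/mem_Str => //; exists s. Qed.

Let in_omega n : vmem (vnat n) omega.
Proof. by apply/mem_omega => //; exists n. Qed.

Let in_theta (xi : below theta) : vmem (proj1_sig xi) theta.
Proof. exact: (proj2_sig xi). Qed.

Let code_indexE (xi : V) (h : vmem xi theta) k :
  opair xi (vnat k) = code_index ((exist _ xi h, k) : Defs.index theta).
Proof. by []. Qed.

Lemma code_tree_setT : code_tree setT = Str.
Proof.
apply: vmem_ext => z; rewrite vmem_code_tree mem_Str //.
by split=> [[s _ ->]|[s ->]]; exists s.
Qed.

Lemma represents_vfunctional a z : represents a z -> vfunctional z.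
Proof.
move=> az xi hx _ /(mem_omega omegaE)[k ->] _ /(mem_omega omegaE)[m ->].
move=> _ /(mem_Str StrE)[t ->] _ /(mem_omega omegaE)[m' ->] _ /(mem_Str StrE)[t' ->].
by rewrite (code_indexE hx) => /az e /az; rewrite e => -[-> ->].
Qed.

Lemma vfunctional_represents z : vfunctional z -> exists a, represents a z.
Proof.
move=> fz.
pose a (p : Defs.index theta) := if pselect (exists mt : nat * seq bool,
  vmem (opair (code_index p) (opair (vnat mt.1) (code_string mt.2))) z) is left h
  then Some (projT1 (cid h)) else None.
exists a => p m t; rewrite /a; case: pselect => [h|h].
  case: (cid h) => -[m' t'] /= e; split=> [e'|[<- <-] //].
  have [||||||/vnat_inj -> /code_string_inj ->] :=
    fz (proj1_sig p.1) _ (vnat p.2) _ (vnat m') _ (code_string t') _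
      (vnat m) _ (code_string t) _ e e' => //.
by split=> // e; case: h; exists (m, t).
Qed.

Lemma finite_assignment_represented a : finite_assignment a ->
  exists2 z, M z & represents a z.
Proof.
move=> fa; pose A : set V := [set z | exists p m t, a p = Some (m, t) /\
  z = opair (code_index p) (opair (vnat m) (code_string t))].
have [||z Mz zE] := model_finite hM (A := A).
- apply: (@sub_finite_set _ _ ((fun p => opair (code_index p)
    (opair (vnat (odflt (0, [::]) (a p)).1) (code_string (odflt (0, [::]) (a p)).2)))
    @` [set p | a p <> None])); last exact: finite_image.
  by move=> z [p [m [t [e ->]]]]; exists p; rewrite /= e.
- move=> z [p [m [t [e ->]]]]; apply: (model_opair hM).
    apply: (model_opair hM); last exact: model_vnat.
    exact: (model_trans hM Mtheta (in_theta p.1)).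
  apply: (model_opair hM); first exact: model_vnat.
  exact: (model_trans hM MStr (in_Str t)).
exists z => // p m t; rewrite -[vmem _ z]/(elts z _) zE; split; last by exists p, m, t.
move=> [q [m' [t' [e /opair_inj[/code_index_inj ->]]]]].
by move=> /opair_inj[/vnat_inj -> /code_string_inj ->].
Qed.

Variables (Phi : multisystem theta).
Hypotheses (PhiP : MS P Phi) (MPhi : M (code_multisystem Phi)).

Lemma vvalP q t T : vval (code_multisystem Phi) (code_index q) (code_string t) T <->
  exists2 T', Phi q t = Some T' & T = code_tree T'.
Proof.
split=> [[phi _ [/mem_code_multisystem -> /mem_code_system //]]|[T' e ->]].
have h : vmem (opair (code_index q) (code_system (Phi q))) (code_multisystem Phi).
  exact/mem_code_multisystem.
exists (code_system (Phi q)).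
  by have [] := model_opair_inv hM (model_trans hM MPhi h).
by split=> //; apply/mem_code_system; exists T'.
Qed.

Lemma model_value q t T : Phi q t = Some T -> M (code_tree T).
Proof.
by move=> e; have [/(_ q)[_ h _] _] := PhiP; exact: (model_code_tree hM MP (h _ _ e)).
Qed.

(** The hypotheses on [y] cover two codings of [sigma]: the full graph, used for elements of [c],
    and the graph on the support alone, used for the part of [nu] over [P]. *)
Lemma vrefinedP a z (sigma : multitree theta) y : represents a z -> M y ->
  (forall p S, vmem (opair (code_index p) S) y -> S = code_tree (sigma p)) ->
  (forall p, sigma p <> setT -> vmem (opair (code_index p) (code_tree (sigma p))) y) ->
  vrefined (code_multisystem Phi) z y <-> mt_refined Phi a sigma.
Proof.
move=> az My ys sy; split=> [h p|h xi hx _ /(mem_omega omegaE)[k ->] S MS'].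
  have [->|pT] := pselect (sigma p = setT); [by left|right].
  have hy := sy p pT.
  have MS' : M (code_tree (sigma p)).
    by have [] := model_opair_inv hM (model_trans hM My hy).
  have [|] := h _ (in_theta p.1) _ (in_omega p.2) _ MS' hy.
    by rewrite -code_tree_setT => /code_tree_inj.
  move=> [_ /(mem_omega omegaE)[m ->] [_ /(mem_Str StrE)[t ->] [T _ [+ [+ TS]]]]].
  move=> /az ap /(vvalP (p.1, m))[T' e TE]; exists m, t, T'; split=> //.
  by apply/code_tree_sub; rewrite -TE.
rewrite (code_indexE hx) => /ys ->.
have [->|[m [t [T [ap e Ts]]]]] := h (exist _ xi hx, k).
  by left; exact: code_tree_setT.
right; exists (vnat m) => //; exists (code_string t) => //; exists (code_tree T).
  exact: model_value e.
split; first exact/az.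
split; first by apply/(vvalP (exist _ xi hx, m)); exists T.
exact/code_tree_sub.
Qed.

Lemma vavoidsP (a0 : assignment theta) (nu : multitree theta) m0 A0 A1 :
  represents a0 A0 -> M A1 ->
  (forall p S, vmem (opair (code_index p) S) A1 -> S = code_tree (nu p)) ->
  (forall p, nu p <> setT -> vmem (opair (code_index p) (code_tree (nu p))) A1) ->
  vavoids A0 A1 (vnat m0) (code_multisystem Phi) <->
  exists s a z, [/\ M z, represents a z & avoids c eta a0 nu m0 Phi s a].
Proof.
move=> a0A MA1 A1nu nuA1.
have cP n (i : bool) : vmem (opair (opair (vnat n) (vnat i))
    (code_set (@code_multitree theta) (c (n, i)))) (code_rname c).
  exact/mem_code_rname.
have MC n i : M (code_set (@code_multitree theta) (c (n, i))).
  by have [] := model_opair_inv hM (model_trans hM Mc (cP n i)).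
have sP n i sigma a z : c (n, i) sigma -> represents a z ->
    vrefined (code_multisystem Phi) z (code_multitree sigma) <-> mt_refined Phi a sigma.
  move=> cs az; apply: vrefinedP => //.
  - by apply: (model_trans hM (MC n i)); apply/vmem_code_set_multitree; exists sigma.
  - by move=> p S /(mem_code_fun _ _ _ _ (small_index theta) (@code_index_inj theta)).
  - by move=> p _; apply/(mem_code_fun _ _ _ _ (small_index theta) (@code_index_inj theta)).
split.
  move=> [_ /(mem_Str StrE)[s ->] [z Mz [/vfunctional_represents[a az]]]].
  move=> [h1 [h2 [/(vrefinedP az MA1 A1nu nuA1) h3 [_ /(mem_omega omegaE)[h ->] h4]]]].
  exists s, a, z; split=> //; split=> //.
  - move=> n ns.
    have [|||C _ [/mem_code_rname -> [sg]]] := h1 (vnat n) _ (vnat (nth false s n)) => //.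
    + by apply/vmem_vnat; exists (nth false s n) => //; case: (nth _ _ _).
    + exact/mem_code_string.
    move=> /vmem_code_set_multitree[sigma cs ->] /(sP _ _ _ _ _ cs az) ref.
    by exists sigma.
  - move=> p m u /a0A ap.
    have [_ /(mem_Str StrE)[t ->] [/code_string_sub ut /az e]] :=
      h2 _ (in_theta p.1) _ (in_omega p.2) _ (in_omega m) _ (in_Str u) ap.
    by exists t.
  - exists h => t th.
    have [|T _ [/(vvalP (eta, m0))[T' e ->] nT]] := h4 (code_string t) (in_Str t).
      by rewrite vdom_code_string th.
    by exists T' => // T's; apply: nT; apply/mem_code_tree.
move=> [s [a [z [Mz az [h1 h2 h3 [h h4]]]]]].
exists (code_string s) => //; exists z => //; split; first exact: represents_vfunctional az.
split; [|split; [|split]].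
- move=> _ /(mem_omega omegaE)[n ->] i0 /vmem_vnat[i i2 ->].
  have -> : vnat i = vnat (i == 1) by case: i i2 => [|[|]].
  move=> /mem_code_string[ns nE]; have [sigma cs ref] := h1 n ns; rewrite nE in cs.
  exists (code_set (@code_multitree theta) (c (n, i == 1))) => //; split=> //.
  exists (code_multitree sigma); first by apply/vmem_code_set_multitree; exists sigma.
  exact/(sP _ _ _ _ _ cs az).
- move=> xi hx _ /(mem_omega omegaE)[k ->] _ /(mem_omega omegaE)[m ->] _ /(mem_Str StrE)[u ->].
  rewrite (code_indexE hx) => /a0A/h2[t ut e].
  exists (code_string t) => //; split; first exact/code_string_sub.
  exact/az.
- exact/(vrefinedP az MA1 A1nu nuA1).
- exists (vnat h) => // _ /(mem_Str StrE)[t ->]; rewrite vdom_code_string => /vnat_inj th.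
  have [T e nT] := h4 t th; exists (code_tree T); first exact: model_value e.
  split; first by apply/(vvalP (eta, m0)); exists T.
  by move=> /mem_code_tree.
Qed.

End AvoidInModel.

(** * Fusion trees *)

Section Fusion.
Variables (theta : V) (P : below theta -> set tree) (Phi : nat -> multisystem theta).
Hypotheses (PhiP : forall j, MS P (Phi j)) (Phi_le : forall j, ms_le (Phi j) (Phi j.+1)).

Lemma sequence_le i j : i <= j -> ms_le (Phi i) (Phi j).
Proof.
elim: j => [|j IH]; first by rewrite leqn0 => /eqP -> p s T.
rewrite leq_eqVlt => /orP[/eqP -> p s T //|].
by rewrite ltnS => /IH h p s T /h; exact: Phi_le.
Qed.

Lemma limit_treeE j p s T : Phi j p s = Some T -> limit_tree Phi p s = T.
Proof.
move=> e; apply/seteqP; split=> [x [T' [i e'] xT']|x xT]; last by exists T; first by exists j.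
suff -> : T = T' by [].
case: (leqP i j) => ij.
  by have := sequence_le ij e'; rewrite e => -[].
by have := sequence_le (ltnW ij) e; rewrite e' => -[].
Qed.

Lemma limit_tree_rcons p s i : limit_tree Phi p (rcons s i) `<=` limit_tree Phi p s.
Proof.
move=> x [T [j e] xT]; have [[n hn] _ hS] := (PhiP j).1 p.
have := hn (rcons s i); rewrite e size_rcons /= => /esym/ltnW sn.
have := hn s; rewrite sn; case e' : (Phi j p s) => [T'|//] _.
by exists T'; [exists j|have [TT' _] := hS _ _ _ _ e' e; exact: TT'].
Qed.

Lemma limit_tree_prefix p s t : prefix s t -> limit_tree Phi p t `<=` limit_tree Phi p s.
Proof.
move=> /prefixP[u ->]; elim/last_ind: u => [|u i IH]; first by rewrite cats0.
by rewrite -rcons_cat; exact: subset_trans (@limit_tree_rcons _ _ _) IH.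
Qed.

Lemma fusion_tree_limit p s : fusion_tree Phi p s `<=` limit_tree Phi p s.
Proof.
move=> x /(_ (size s) (leqnn _))[t [ts st]].
suff -> : s = t by [].
by apply: comparable_size_eq; [left|].
Qed.

Lemma fusion_tree_prefix p s t : prefix s t -> fusion_tree Phi p t `<=` fusion_tree Phi p s.
Proof.
move=> st x xt n /= sn; case: (leqP (size t) n) => tn.
  by have [u [us tu] xu] := xt n tn; exists u => //; split=> //; exact: prefix_trans tu.
(* At a level shorter than [t] the relevant node is an initial segment of [t], whose limit tree
   contains that of [t]. *)
exists (take n t).
  split; first by rewrite size_takel // ltnW.
  move: st; rewrite prefixE => /eqP <-; rewrite -(take_takel t sn).
  by apply/prefixP; exists (drop (size s) (take n t)); rewrite cat_take_drop.
by apply: limit_tree_prefix (fusion_tree_limit xt); rewrite -{2}(cat_take_drop n t) prefix_prefix.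
Qed.

End Fusion.

(** * Separating the nodes given by [nu], and the conclusion *)

Lemma incomparable_refinement (theta : V) (S : set (Defs.index theta))
    (f : Defs.index theta -> nat * seq bool) : finite_set S ->
  exists a : assignment theta, [/\ finite_assignment a, incomparable_assignment a,
    forall p, S p -> exists2 t, prefix (f p).2 t & a p = Some ((f p).1, t)
    & forall p, a p <> None -> S p].
Proof.
move=> fS; have [g gS] := finite_numbering fS.
have [L LS] := finite_set_bound (fun p => size (f p).2) fS.
(* Padding to the common length [L] lets all tails start at the same position. A tail has [g p]
   entries [true] and then [false], so tails for different [g p] are incomparable. *)
pose code p := pad L (f p).2 ++ rcons (nseq (g p) true) false.
pose a p := if pselect (S p) then Some ((f p).1, code p) else None.
have aS p : a p <> None -> S p by rewrite /a; case: pselect.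
have aP p m t : a p = Some (m, t) -> S p /\ t = code p.
  by rewrite /a; case: pselect => //= Sp [_ <-].
have sz p : S p -> size (code p) = (L + g p).+1.
  by move=> /LS/ltnW h; rewrite size_cat size_pad // size_rcons size_nseq addnS.
have nt p i : S p -> i <= g p -> nth false (code p) (L + i) = (i < g p).
  move=> /LS/ltnW h ig; rewrite nth_cat size_pad // ltnNge leq_addr /= addKn.
  rewrite nth_rcons size_nseq nth_nseq; case: ltnP => //.
  by rewrite leq_eqVlt ltnNge ig orbF eq_sym => ->.
exists a; split=> //.
- exact: sub_finite_set fS.
- move=> p q m s t _ /aP[Sp ->] /aP[Sq ->] cpq; apply: gS => //.
  wlog lt : p q Sp Sq cpq / g p < g q.
    move=> W; case: (ltngtP (g p) (g q)) => // h; first exact: W h.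
    apply/esym; apply: W h => //; by case: cpq; [right|left].
  have := comparable_nth cpq (n := L + g p); rewrite !sz //.
  rewrite ltnS leqnn ltnS leq_add2l (ltnW lt) => /(_ isT isT).
  by rewrite !nt ?ltnn ?lt // ltnW.
- move=> p Sp; exists (code p); last by rewrite /a; case: pselect.
  exact: prefix_trans (pad_prefix L _) (prefix_prefix _ _).
Qed.

Theorem theorem5p3
  (M : set V) (hM : countable_transitive_model M)
  (theta : V) (htheta : lt_omega1_in M theta)
  (P : below theta -> set tree)
  (hPM : M (code_family P))
  (hP : forall xi, ptforcing (P xi))
  (hPcount : forall xi, countable_in M (code_set code_tree (P xi)))
  (Phi : nat -> multisystem theta)
  (hPhi : generic_sequence M P Phi)
  (eta : below theta)
  (c : rname theta)
  (hcM : M (code_rname c))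
  (hc : real_name P c)
  (hD : forall k : nat,
      mt_dense P
        [set tau | MT P tau /\ forces_neq tau c (pi_name (eta, k))])
  (nu : multitree theta)
  (hnu : MT (family_join P (fusion_family Phi)) nu)
  (U : tree) (hU : fusion_family Phi eta U) :
  exists nu' : multitree theta,
    [/\ MT (fusion_family Phi) nu', mt_le nu' nu & forces_notin nu' c U].
Proof.
have [Mtheta _ _] := htheta; have [PhiP Phi_le Phi_gen] := hPhi.
have [Str MStr StrE] := model_strings hM.
have [omega Momega omegaE] := model_omega hM.
have [m0 [u0 UE]] := hU; have [nuF fnu] := hnu.
(* The coordinates of [nu] to be governed by systems. Where [P p.1] is empty no system can grow, and
   these coordinates are treated separately. *)
pose fus p := [/\ Defs.support nu p, ~ P p.1 (nu p) & P p.1 !=set0].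
have /choice[f fP] : forall p, exists ms : nat * seq bool,
    Defs.support nu p -> ~ P p.1 (nu p) -> nu p = fusion_tree Phi (p.1, ms.1) ms.2.
  move=> p; have [[//|[m [s e]]]|e] := nuF p; first by exists (0, [::]).
    by exists (m, s).
  by exists (0, [::]).
have ffus : finite_set fus by apply: sub_finite_set fnu => p [].
have [a0 [fa0 ia0 a0s a0fus]] := incomparable_refinement f ffus.
(* The part of [nu] over [P], whose trees are in the model; a component in both families is counted
   here. *)
pose nu1 p := if pselect (P p.1 (nu p)) then nu p else setT.
have nu1E p : P p.1 (nu p) /\ nu1 p = nu p \/ ~ P p.1 (nu p) /\ nu1 p = setT.
  by rewrite /nu1; case: pselect; [left|right].
have nu1P : MT P nu1.
  split=> [p|]; first by case: (nu1E p) => -[h ->]; [left|right].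
  apply: sub_finite_set fnu => p; rewrite /Defs.support /=.
  by case: (nu1E p) => -[h ->].
have a0P p m s : a0 p = Some (m, s) -> P p.1 !=set0 /\ nu1 p = setT.
  move=> e; have [|_ nP nP0] := a0fus p; first by rewrite e.
  by split=> //; case: (nu1E p) => -[].
have [A0 MA0 a0A] := finite_assignment_represented hM Mtheta MStr StrE fa0.
(* Coding the support alone gives a finite set, which therefore belongs to [M]. *)
pose A : set V := (fun p => opair (code_index p) (code_tree (nu1 p))) @` Defs.support nu1.
have [||A1 MA1 A1E] := model_finite hM (A := A).
- exact: finite_image (proj2 nu1P).
- move=> _ [p pnu <-]; apply: (model_opair hM).
    apply: (model_opair hM); last exact: model_vnat.
    exact: (model_trans hM Mtheta (proj2_sig p.1)).
  case: (nu1E p) => -[h e]; last by case: pnu.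
  by rewrite e; exact: (model_code_tree hM hPM h).
have A1nu p S : vmem (opair (code_index p) S) A1 -> S = code_tree (nu1 p).
  rewrite -[vmem _ _]/(elts _ _) A1E => -[q _ /opair_inj[/code_index_inj -> ->]] //.
have nuA1 p : nu1 p <> setT -> vmem (opair (code_index p) (code_tree (nu1 p))) A1.
  by move=> h; rewrite -[vmem _ _]/(elts _ _) A1E; exists p.
have [B MB BE] := model_multisystems hM Mtheta hPM hP.
have MMS Psi : MS P Psi -> M (code_multisystem Psi).
  by move=> h; apply: (model_trans hM MB); rewrite -[vmem _ _]/(elts _ _) BE; exists Psi.
pose D := [set Psi | MS P Psi /\ vavoids M c eta Str omega A0 A1 (vnat m0) (code_multisystem Psi)].
have DE Psi (h : MS P Psi) := vavoidsP hM hPM hcM eta StrE omegaE h (MMS _ h) m0 a0A MA1 A1nu nuA1.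
have [||j [_ /(DE _ (PhiP j))[s [a [z [_ _ [h1 h2 h3 [h h4]]]]]]]] := Phi_gen D.
- split=> [Psi []//|Psi PsiP].
  have [Chi [s [a [ChiP le fa av]]]] := avoids_dense hP hc hD m0 fa0 ia0 a0P nu1P PsiP.
  exists Chi => //; split=> //; apply/(DE _ ChiP); exists s, a.
  by have [z Mz az] := finite_assignment_represented hM Mtheta MStr StrE fa; exists z.
- apply: (model_definable_multisystems hM Mtheta hPM hP
    (R := fun z => vavoids M c eta Str omega A0 A1 (vnat m0) z)).
  by apply: definable_vavoids => //; exact: model_vnat.
have /choice[sg sgP] : forall n, exists sigma, n < size s ->
    c (n, nth false s n) sigma /\ mt_refined (Phi j) a sigma.
  move=> n; have [/h1[sigma cs ref]|_] := boolP (n < size s); first by exists sigma.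
  by exists nu.
have sgMT n : n < size s -> MT P (sg n).
  by move=> ns; have [cP _ _] := hc; have [cs _] := sgP n ns; exact: cP cs.
(* The assignment [a] obtained from genericity is known only to be represented in [M]. Cutting it
   down to the coordinates that occur in [nu] and in the chosen [sg n] gives [nu'] finite
   support. *)
pose S := Defs.support nu `|` \bigcup_(n in `I_(size s)) Defs.support (sg n).
have fS : finite_set S.
  rewrite finite_setU; split=> //; apply: bigcup_finite; first exact: finite_II.
  by move=> n ns; exact: (proj2 (sgMT n ns)).
(* A component of [nu] in the support over an empty [P p.1] comes from the fusion family, so it can
   stay in [nu']. *)
pose bad p := Defs.support nu p /\ ~ (P p.1 !=set0).
pose nu' : multitree theta := fun p => if pselect (bad p) then nu p else
  if pselect (S p) then
    (if a p is Some (m, t) then fusion_tree Phi (p.1, m) t else setT) else setT.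
have nu'E p m t : ~ bad p -> S p -> a p = Some (m, t) ->
    nu' p = fusion_tree Phi (p.1, m) t.
  by move=> nb Sp e; rewrite /nu'; case: pselect => //= _; case: pselect => //= _; rewrite e.
(* The fusion tree at an assigned node lies inside the tree of [Phi j] at that node, so refinement
   at stage [j] carries over to [nu']. *)
have ref_le sigma : MT P sigma -> Defs.support sigma `<=` S ->
    mt_refined (Phi j) a sigma -> mt_le nu' sigma.
  move=> sP sS ref p; have [->//|[m [t [T [ap e Ts]]]]] := ref p.
  have [->//|sp] := pselect (sigma p = setT).
  rewrite (nu'E p m t) //.
  - apply: subset_trans Ts => x /fusion_tree_limit.
    by rewrite (limit_treeE Phi_le e).
  - by move=> [_]; apply; exists (sigma p); case: sP => /(_ p)[].
  - exact: sS.
exists nu'; split.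
- split=> [p|].
    rewrite /nu'; case: pselect => [[sp nP]|nb] /=.
      left; have [[h'|//]|//] := nuF p; by case: nP; exists (nu p).
    case: pselect => /= Sp; last by right.
    by case: (a p) => [[m t]|]; [left; exists m, t|right].
  apply: sub_finite_set fS => p; rewrite /Defs.support /= /nu'.
  by case: pselect => [[sp _] _|nb] /=; [left|case: pselect].
- move=> p; have [->//|sp] := pselect (nu p = setT).
  have [[h' e]|[nP _]] := nu1E p.
    rewrite -e; apply: ref_le => // q qs; left.
    by move: qs; rewrite /Defs.support /=; case: (nu1E q) => -[_ ->].
  have [P0|P0] := pselect (P p.1 !=set0); last first.
    by rewrite /nu'; case: pselect => [b|nb] //=; case: nb.
  have [t0 ft0 e0] := a0s p (And3 sp nP P0); have [t t0t e] := h2 _ _ _ e0.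
  rewrite (nu'E _ _ _ _ _ e); [|by case|by left].
  rewrite (fP p sp nP); apply: (fusion_tree_prefix PhiP).
  exact: prefix_trans ft0 t0t.
exists s.
  (* [U] is contained in the root fusion tree, so a string of [U] belongs to some tree of level [h];
     none of these contains [s]. *)
  rewrite UE => /(fusion_tree_prefix PhiP (prefix0s _)) /(_ h (leq0n _))[t [th _]].
  by have [T e nT] := h4 t th; rewrite (limit_treeE Phi_le e).
move=> n ns; have [cs ref] := sgP n ns; exists [set sg n]; split.
- exact: finite_set1.
- by move=> _ ->.
move=> x xnu'; exists (sg n) => //; apply: mt_body_le xnu'.
by apply: ref_le => //; [exact: sgMT|move=> p ps; right; exists n].
Qed.
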